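(* Let $D\subset\mathbb{C}^n$ be a bounded strongly pseudoconvex domain with smooth boundary, let $0<p\le 1$, $0<q\le 1$ and $\beta>0$. Then there exists $\tilde\alpha_0$ (depending on $D,n,p,q,\beta$) such that for every $\alpha>\tilde\alpha_0$ the operator $$ (T_\alpha f)(w)=\int_D K_{\alpha_0}(w,z)\, f(z)\, dv_\alpha(z),\qquad w\in D,\qquad \alpha_0=\alpha+n+1, $$ where $K_{\alpha_0}$ is a kernel of type $\alpha$ and $dv_\alpha=\rho^\alpha\,dv$, maps $A^{p,q}_\beta(D)$ boundedly into $A^{p,q}_\beta(D)$; that is, there is a constant $C$ such that for every $f\in A^{p,q}_\beta(D)$ the function $T_\alpha f$ is well defined, belongs to $A^{p,q}_\beta(D)$, and $\|T_\alpha f\|_{p,q,\beta}\le C\|f\|_{p,q,\beta}$.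
   Context: Domain and defining function. $D\subset\mathbb{C}^n$ is a bounded strongly pseudoconvex domain with smooth boundary. Fix a neighbourhood $U$ of $\bar D$ and $\rho\in C^\infty(U)$ such that $D=\{z\in U:\rho(z)>0\}$, $|d\rho(z)|\ge c>0$ for $z\in\partial D$, $0<\rho(z)<1$ for $z\in D$, and $-\rho$ is strictly plurisubharmonic in a neighbourhood of $\partial D$. Then $\rho(z)\asymp \mathrm{dist}(z,\partial D)$ on $D$. Fix $r_0>0$ such that for all $0<r\le r_0$ the domains $D_r=\{z\in D:\rho(z)>r\}$ are also smoothly bounded strictly pseudoconvex domains. Let $d\sigma_r$ be the normalized surface measure on $\partial D_r$, let $dv$ be the normalized Lebesgue measure on $D$, and put $dv_\alpha(z)=\rho(z)^\alpha dv(z)$. $H(D)$ is the space of holomorphic functions on $D$. Spaces. For $0<p,q<\infty$ and $\delta>0$, $$ \|f\|_{p,q,\delta}=\left(\int_0^{r_0}\left(r^\delta\int_{\partial D_r}|f|^p\,d\sigma_r\right)^{q/p}\frac{dr}{r}\right)^{1/q},\qquad A^{p,q}_\delta(D)=\{f\in H(D):\|f\|_{p,q,\delta}<\infty\}. $$ Kernels. $\tilde\Phi(z,\xi)$ denotes the Henkin–Ramirez function of $D$: it is $C^\infty$ on $U\times U$, holomorphic in $z$, satisfies $\tilde\Phi(\xi,\xi)=\rho(\xi)$ for $\xi\in U$, on $\bar D\times\bar D$ it vanishes only at the points $(\xi,\xi)$ with $\xi\in\partial D$, and locally (near the boundary diagonal) it equals, up to a non-vanishing smooth multiplicative factor, the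 Levi polynomial of $\rho$, $$ \rho(\xi)+\sum_{j}\frac{\partial\rho}{\partial\xi_j}(\xi)(z_j-\xi_j)+\frac12\sum_{j,k}\frac{\partial^2\rho}{\partial\xi_j\partial\xi_k}(\xi)(z_j-\xi_j)(z_k-\xi_k). $$ For $t>-1$ and $\tilde t=t+n+1$, a kernel of type $t$ is a smooth function $K_{\tilde t}(z,\xi)$ on $D\times D$, holomorphic in $z$, such that $|K_{\tilde t}(z,\xi)|\le C_1|\tilde\Phi(z,\xi)|^{-(n+1+t)}$ on $D\times D$. The kernels $K_{\tilde t}$ used here are the reproducing ones, i.e. $f(z)=\int_D f(\xi)K_{\tilde t}(z,\xi)\rho(\xi)^t\,dv(\xi)$ for $z\in D$ and every $f\in H(D)$ with $\int_D|f|\rho^t\,dv<\infty$. *)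

(* Defs.v *)
From HB Require Import structures.
From mathcomp Require Import all_boot all_order all_algebra.
From mathcomp Require Import all_classical all_reals all_analysis.
From mathcomp Require Import complex.

Set Implicit Arguments.
Unset Strict Implicit.
Unset Printing Implicit Defensive.

Import Order.TTheory GRing.Theory Num.Theory.
Import numFieldNormedType.Exports.

Local Open Scope classical_set_scope.
Local Open Scope ring_scope.
Local Open Scope complex_scope.

Local Notation Re := complex.Re.
Local Notation Im := complex.Im.

(* The symbol 'i of ring_scope denotes an abstract imaginary unit. *)
Local Notation iC := (Complex 0 1).

(* [R[i]^o] rather than [R[i]]: the former carries the topology and the norm. *)
Notation Cn R n := 'rV[R[i]^o]_n.

Notation CnB R n := (g_sigma_algebraType (@open (Cn R n))).

Section Metric.
Variables (R : realType) (n : nat).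
Implicit Types (z w : Cn R n) (A : set (Cn R n)).

Definition cmod (x : R[i]) : R := ComplexField.Normc.normc x.

(* The library norm on row vectors is the sup norm. *)
Definition enorm z : R := Num.sqrt (\sum_(j < n) cmod (z 0 j) ^+ 2).

Definition ebounded A : Prop := exists M : R, forall z, A z -> enorm z <= M.

Definition frontier A : set (Cn R n) := closure A `\` interior A.

Definition ediam A : \bar R :=
  ereal_sup ([set 0%E] `|`
    [set e | exists z w, [/\ A z, A w & e = (enorm (z - w))%:E]]).

End Metric.

Section RealDerivatives.
Variables (R : realType) (n : nat).
Implicit Types (u : Cn R n -> R) (f : Cn R n -> R[i]) (A : set (Cn R n)).

(* c = 1 gives the x_j-direction, c = iC the y_j-direction. *)
Definition line (c : R[i]) (j : 'I_n) (z : Cn R n) (t : R) : Cn R n :=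
  z + (t%:C * c) *: delta_mx 0 j.

Definition rpartial (c : R[i]) (j : 'I_n) u (z : Cn R n) : R :=
  derive1 (fun t : R => u (line c j z t)) 0.

Fixpoint Ck_on (k : nat) A u : Prop :=
  (forall z, A z -> {for z, continuous u}) /\
  (if k is k'.+1 then
     forall (j : 'I_n) (c : R[i]), c = 1 \/ c = iC ->
       (forall z, A z -> derivable (fun t : R => u (line c j z t)) 0 1) /\
       Ck_on k' A (rpartial c j u)
   else True).

Definition smooth_on A u : Prop := forall k, Ck_on k A u.

Definition csmooth_on A f : Prop :=
  smooth_on A (fun z => Re (f z)) /\ smooth_on A (fun z => Im (f z)).

Definition cpartial (c : R[i]) (j : 'I_n) f (z : Cn R n) : R[i] :=
  rpartial c j (fun w => Re (f w)) z +i* rpartial c j (fun w => Im (f w)) z.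

Definition dz (j : 'I_n) f (z : Cn R n) : R[i] :=
  (cpartial 1 j f z - iC * cpartial iC j f z) / 2%:R.

Definition dzbar (j : 'I_n) f (z : Cn R n) : R[i] :=
  (cpartial 1 j f z + iC * cpartial iC j f z) / 2%:R.

(* Euclidean norm of the real differential of u at z. *)
Definition dnorm u (z : Cn R n) : R :=
  Num.sqrt (\sum_(j < n) (rpartial 1 j u z ^+ 2 + rpartial iC j u z ^+ 2)).

Definition levi_form u (z a : Cn R n) : R[i] :=
  \sum_(j < n) \sum_(k < n)
    dz j (dzbar k (fun w => (u w)%:C)) z * a 0 j * conjc (a 0 k).

(* u is assumed C^2 wherever this is used. *)
Definition strictly_psh_on A u : Prop :=
  forall z a : Cn R n, A z -> a != 0 -> 0 < Re (levi_form u z a).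

Definition levi_polynomial u (z xi : Cn R n) : R[i] :=
  let U w := (u w)%:C in
  U xi
  + \sum_(j < n) dz j U xi * (z 0 j - xi 0 j)
  + 2%:R^-1 * \sum_(j < n) \sum_(k < n)
      dz j (dz k U) xi * (z 0 j - xi 0 j) * (z 0 k - xi 0 k).

(* Holomorphic = complex Frechet differentiable at each point of the open A. *)
Definition holomorphic_on A f : Prop :=
  forall z, A z -> differentiable (f : Cn R n -> R[i]^o) z.

End RealDerivatives.

(* A pair (z, xi) of points of C^n is read as a point of C^(n+n). *)
Definition setXX (R : realType) (n : nat) (A : set (Cn R n)) :
    set (Cn R (n + n)) :=
  [set w | A (lsubmx w) /\ A (rsubmx w)].

Definition uncurry2 (R : realType) (n : nat) (F : Cn R n -> Cn R n -> R[i]) :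
    Cn R (n + n) -> R[i] :=
  fun w => F (lsubmx w) (rsubmx w).

Section Domains.
Variables (R : realType) (n : nat).
Implicit Types (D U : set (Cn R n)) (rho : Cn R n -> R).

Record defining_function D U rho : Prop := DefiningFunction {
  df_open : open U;
  df_nbhs : closure D `<=` U;
  df_smooth : smooth_on U rho;
  df_eq : D = [set z | U z /\ 0 < rho z];
  df_grad : exists2 c : R, 0 < c & forall z, frontier D z -> c <= dnorm rho z;
  df_lt1 : forall z, D z -> rho z < 1;
  df_psh : exists V : set (Cn R n),
    [/\ open V, frontier D `<=` V, V `<=` U &
        strictly_psh_on V (fun z => - rho z)]
}.

(* Bounded strongly pseudoconvex domain with smooth boundary. *)
Record spc_domain D : Prop := SpcDomain {
  spc_open : open D;
  spc_connected : connected D;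
  spc_nonempty : D !=set0;
  spc_bounded : ebounded D;
  spc_defining : exists U rho, defining_function D U rho
}.

Definition level_domain D rho (r : R) : set (Cn R n) :=
  [set z | D z /\ r < rho z].

Record henkin_ramirez D U rho (Phi : Cn R n -> Cn R n -> R[i]) : Prop :=
  HenkinRamirez {
  hr_smooth : csmooth_on (setXX U) (uncurry2 Phi);
  hr_holo : forall xi, U xi -> holomorphic_on U (fun z => Phi z xi);
  hr_diag : forall xi, U xi -> Phi xi xi = (rho xi)%:C;
  hr_zero : forall z xi, closure D z -> closure D xi ->
    (Phi z xi = 0 <-> z = xi /\ frontier D xi);
  hr_levi : forall xi0, frontier D xi0 ->
    exists (W : set (Cn R n)) (A : Cn R n -> Cn R n -> R[i]),
      [/\ open W, W xi0, W `<=` U, csmooth_on (setXX W) (uncurry2 A) &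
          forall z xi, W z -> W xi ->
            A z xi != 0 /\ Phi z xi = A z xi * levi_polynomial rho z xi]
}.

End Domains.

Section Measures.
Variable R : realType.
Local Open Scope ereal_scope.

(* Lebesgue measure of C^n = C x C^(n-1) as an iterated product measure, the
   plane carrying lebesgue_measure \x lebesgue_measure; only its values on
   Borel sets are relevant. *)
Fixpoint lebesgueC (n : nat) : set (Cn R n) -> \bar R :=
  match n with
  | 0%N => fun A => \d_(0%R : CnB R 0) A
  | m.+1 => fun A =>
      \int[(@lebesgue_measure R) \x (@lebesgue_measure R)]_xy
        lebesgueC [set v : Cn R m |
          A (row_mx ((xy.1 +i* xy.2)%:M : 'M[R[i]^o]_1) v : Cn R (1 + m))]
  end.

(* s-dimensional Hausdorff measure for the Euclidean distance, without
   dimensional constant. *)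
Definition hausdorff_pre (n s : nat) (d : R) (A : set (Cn R n)) : \bar R :=
  ereal_inf [set e | exists U : nat -> set (Cn R n),
    [/\ A `<=` \bigcup_k U k, forall k, ediam (U k) <= d%:E &
        e = \sum_(0 <= k <oo) ediam (U k) ^+ s]].

Definition hausdorff (n s : nat) (A : set (Cn R n)) : \bar R :=
  ereal_sup [set hausdorff_pre s d A | d in [set d : R | (0 < d)%R]].

Definition normalized (n : nat) (mu : set (Cn R n) -> \bar R)
    (B : set (Cn R n)) : set (CnB R n) -> \bar R :=
  fun A => mu (A `&` B) * ((fine (mu B))^-1)%:E.

Definition volume (n : nat) (D : set (Cn R n)) : set (CnB R n) -> \bar R :=
  normalized (@lebesgueC n) D.

(* Normalized surface measure on the boundary of G: the (2n-1)-dimensional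
   Hausdorff measure; its dimensional constant cancels in the normalization. *)
Definition surface (n : nat) (G : set (Cn R n)) : set (CnB R n) -> \bar R :=
  normalized (@hausdorff n (n.*2.-1)) (frontier G).

Definition cintegrable (n : nat) (mu : set (CnB R n) -> \bar R)
    (D : set (CnB R n)) (f : CnB R n -> R[i]) : Prop :=
  mu.-integrable D (fun z => (Re (f z))%:E) /\
  mu.-integrable D (fun z => (Im (f z))%:E).

Definition cintegral (n : nat) (mu : set (CnB R n) -> \bar R)
    (D : set (CnB R n)) (f : CnB R n -> R[i]) : R[i] :=
  fine (\int[mu]_(z in D) (Re (f z))%:E) +i*
  fine (\int[mu]_(z in D) (Im (f z))%:E).

End Measures.

Section Spaces.
Variables (R : realType) (n : nat).
Implicit Types (D : set (Cn R n)) (rho : Cn R n -> R) (f : Cn R n -> R[i]).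
Local Open Scope ereal_scope.

Definition pqnorm D rho (r0 p q delta : R) f : \bar R :=
  (\int[@lebesgue_measure R]_(r in `]0%R, r0])
     (((r `^ delta)%:E *
       \int[surface (level_domain D rho r)]_(z in frontier (level_domain D rho r))
         ((cmod (f z)) `^ p)%:E) `^ (q / p) * (r^-1)%:E)) `^ (q^-1).

Definition Apq D rho (r0 p q delta : R) f : Prop :=
  holomorphic_on D f /\ pqnorm D rho r0 p q delta f < +oo.

End Spaces.

Section Kernels.
Variables (R : realType) (n : nat).
Implicit Types (D : set (Cn R n)) (rho : Cn R n -> R) (f : Cn R n -> R[i]).
Implicit Types (Phi K : Cn R n -> Cn R n -> R[i]).

Record kernel_of_type D Phi (t : R) K : Prop := KernelOfType {
  ker_type : -1 < t;
  ker_smooth : csmooth_on (setXX D) (uncurry2 K);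
  ker_holo : forall xi, D xi -> holomorphic_on D (fun z => K z xi);
  ker_bound : exists C1 : R, forall z xi, D z -> D xi ->
    cmod (K z xi) <= C1 * cmod (Phi z xi) `^ (- (n%:R + 1 + t))
}.

Definition reproducing D rho (t : R) K : Prop :=
  forall f, holomorphic_on D f ->
  (\int[volume D]_(xi in D) (cmod (f xi) * rho xi `^ t)%:E < +oo)%E ->
  forall z, D z ->
    f z = cintegral (volume D) D (fun xi => f xi * K z xi * (rho xi `^ t)%:C).

Definition T_integrand rho (alpha : R) K f (w z : Cn R n) : R[i] :=
  K w z * f z * (rho z `^ alpha)%:C.

Definition T_op D rho (alpha : R) K f : Cn R n -> R[i] :=
  fun w => cintegral (volume D) D (T_integrand rho alpha K f w).

End Kernels.

(* Main.v *)
Require Import Defs.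
From HB Require Import structures.
From mathcomp Require Import all_boot all_order all_algebra.
From mathcomp Require Import all_classical all_reals all_analysis.
From mathcomp Require Import measurable_realfun complex ring lra.

(** The kernel reproduces: as soon as f is holomorphic with |f| rho^alpha
    integrable on D, the function T_alpha f coincides with f on D, and the
    estimate holds with constant 1. The theorem therefore amounts to the inclusion
    of A^{p,q}_beta in the weighted space L^1(rho^alpha) for all large alpha, and
    this follows from a polynomial growth bound: every f of finite mixed norm
    satisfies |f| <= B rho^{-N} on D, where N depends on n, p, q and beta only
    ([growth_bound]; any N >= (beta + 2n - 1)/p + 1/q will do). Then every
    alpha > N is admissible. The level sets over which the norm integrates lie
    inside D, so that f and T_alpha f have the same norm ([pqnorm_eq]).

    Growth bound. Fix eps > 0 and choose z that nearly maximizes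
    |f| (rho - eps)^N over the points where rho >= eps; put d = rho z - eps. If z
    stays away from the boundary, |f z| is bounded by compactness. Otherwise, by the
    choice of z, |f| <= 2^{N+1} |f z| on a box of size comparable to d about z.
    Cauchy's estimate then gives |f| >= |f z|/2 on a smaller box, still of size
    comparable to d. Each level set {rho = r}, with r in an interval of length
    comparable to d below rho z, meets this box in a set of Hausdorff measure at
    least c d^{2n-1} ([level_hausdorff_lower]), while the total measure of the
    level set is at most a constant C0 for small r ([level_hausdorff_upper]). So the mixed norm
    controls |f z| d^N, with a constant that does not depend on eps. Arguing with a
    point of near maximum, instead of the mean value property of |f|^p over D,
    makes a coarea formula for Hausdorff measure unnecessary: the integrand of the
    norm is bounded below by a constant on an interval of levels.

    Hausdorff measure. Lower bounds come from projections: a set covering a cube of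
    side s after forgetting one real coordinate has measure of order s^{2n-1}
    ([hausdorff_ge_cube]), because countably many cubes covering a cube have at
    least its volume ([cover_volume]). Upper bounds come from covers: where a
    partial derivative of rho stays away from 0 the level sets are Lipschitz graphs,
    and a grid of mesh h/m yields m^{2n-1} pieces of diameter O(1/m).

    Cauchy's estimate. Holomorphy means complex differentiability at each point, so
    the derivative is not known to be continuous beforehand. Goursat's lemma for
    rectangles ([goursat]) is proved by bisection; applied to
    (f(w) - f(0))/w^2 - f'(0)/w around the centre of a square it yields
    |f'(0)| <= 8 M / r ([cauchy_estimate]).

    The measures in the statement are only set functions. Integrals against them
    are suprema over simple functions, and two properties are enough: a
    lower bound through a constant on a measurable set ([integral_ge_cst]), and an
    upper bound for bounded functions, which needs only superadditivity
    ([integral_le_cst], [lebesgueC_superadd]). *)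

Set Implicit Arguments.
Unset Strict Implicit.
Unset Printing Implicit Defensive.

Import Order.TTheory GRing.Theory Num.Theory.
Import numFieldNormedType.Exports.

Local Open Scope classical_set_scope.
Local Open Scope ring_scope.
Local Open Scope complex_scope.

Local Notation Re := complex.Re.
Local Notation Im := complex.Im.
Local Notation iC := (Complex 0 1).

(** * Real coordinates on C^n *)

Section ComplexModulus.
Variable R : realType.
Implicit Types x y : R[i].

Lemma cmodE x : `|x| = (cmod x)%:C. Proof. by case: x. Qed.

Lemma cmod_ge0 x : 0 <= cmod x.
Proof. by case: x => a b; exact: sqrtr_ge0. Qed.

Lemma cmodM x y : cmod (x * y) = cmod x * cmod y.
Proof. exact: ComplexField.Normc.normcM. Qed.

Lemma cmodV x : cmod x^-1 = (cmod x)^-1.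
Proof. exact: ComplexField.Normc.normcV. Qed.

Lemma cmodX x k : cmod (x ^+ k) = cmod x ^+ k.
Proof.
elim: k => [|k IH]; first by rewrite !expr0; exact: ComplexField.Normc.normc1.
by rewrite !exprS cmodM IH.
Qed.

Lemma cmod_eq0 x : cmod x = 0 -> x = 0.
Proof. exact: ComplexField.Normc.eq0_normc. Qed.

Lemma cmod_gt0 x : x != 0 -> 0 < cmod x.
Proof.
by move=> x0; rewrite lt_def cmod_ge0 andbT; apply: contra_neq x0; exact: cmod_eq0.
Qed.

Lemma cmod0 : cmod (0 : R[i]) = 0.
Proof. exact: ComplexField.Normc.normc0. Qed.

Lemma cmodN x : cmod (- x) = cmod x.
Proof. exact: normcN. Qed.

Lemma cmodD x y : cmod (x + y) <= cmod x + cmod y.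
Proof. exact: le_normcD. Qed.

Lemma cmodB x y : cmod (x - y) = cmod (y - x).
Proof. by rewrite -cmodN opprB. Qed.

Lemma cmod_real (a : R) : cmod a%:C = `|a|.
Proof. by rewrite /cmod /= expr0n addr0 sqrtr_sqr. Qed.

Lemma normRe_le x : `|Re x| <= cmod x.
Proof.
by case: x => a b /=; rewrite -sqrtr_sqr ler_wsqrtr// lerDl sqr_ge0.
Qed.

Lemma normIm_le x : `|Im x| <= cmod x.
Proof.
by case: x => a b /=; rewrite -sqrtr_sqr ler_wsqrtr// lerDr sqr_ge0.
Qed.

Lemma cmod_le_ReIm x : cmod x <= `|Re x| + `|Im x|.
Proof.
case: x => a b /=; rewrite -[leRHS]ger0_norm ?addr_ge0// -sqrtr_sqr.
apply: ler_wsqrtr; rewrite -(real_normK (num_real a)) -(real_normK (num_real b)).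
by have := mulr_ge0 (normr_ge0 a) (normr_ge0 b); nra.
Qed.

Lemma ReD x y : Re (x + y) = Re x + Re y. Proof. by case: x; case: y. Qed.
Lemma ImD x y : Im (x + y) = Im x + Im y. Proof. by case: x; case: y. Qed.
Lemma ReB x y : Re (x - y) = Re x - Re y. Proof. by case: x; case: y. Qed.
Lemma ImB x y : Im (x - y) = Im x - Im y. Proof. by case: x; case: y. Qed.

Lemma complex_ext x y : Re x = Re y -> Im x = Im y -> x = y.
Proof. by case: x; case: y => /= ? ? ? ? -> ->. Qed.

End ComplexModulus.

Section Coordinates.
Variables (R : realType) (n : nat).
Implicit Types (z w : Cn R n) (i : 'I_n * bool) (u : Cn R n -> R).

Definition crd z i : R := if i.2 then Im (z 0 i.1) else Re (z 0 i.1).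

(** Boxes in the 2n real coordinates, rather than balls, because the partial
    derivatives at hand move one real coordinate at a time and boxes are stable
    under replacing one coordinate by another. *)
Definition near_box (e : R) z w := forall i, `|crd w i - crd z i| < e.

Definition dir (b : bool) : R[i] := if b then iC else 1.

Lemma crd_line (k : 'I_n * bool) z t i :
  crd (line (dir k.2) k.1 z t) i = crd z i + (if i == k then t else 0).
Proof.
case: k i => [j b] [j' b']; rewrite /crd /line /dir !mxE /=.
rewrite xpair_eqE; case: (j' == j); case: b; case: b';
  rewrite /= ?(mulr0, mulr1) /=; case: (z 0 j') => ? ? /=;
  by rewrite ?(mulr0, mulr1, addr0, subr0, mul0r, mul1r).
Qed.

Lemma crdB z w i : crd (z - w) i = crd z i - crd w i.
Proof.
by case: i => j []; rewrite /crd !mxE; case: (z 0 j); case: (w 0 j).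
Qed.

Lemma crd_inj z w : (forall i, crd z i = crd w i) -> z = w.
Proof.
move=> h; apply/rowP => j; apply: complex_ext.
  exact: (h (j, false)).
exact: (h (j, true)).
Qed.

Lemma normr_crd_le z i : `|crd z i| <= cmod (z 0 i.1).
Proof. by rewrite /crd; case: ifP => _; [exact: normIm_le|exact: normRe_le]. Qed.

Lemma near_box_le e e' z w : e <= e' -> near_box e z w -> near_box e' z w.
Proof. by move=> ee' h i; apply: lt_le_trans (h i) ee'. Qed.

Lemma near_box_trans e e' x y z :
  near_box e x y -> near_box e' y z -> near_box (e + e') x z.
Proof.
move=> h h' i; rewrite -(subrKA (crd y i)) addrC.
by apply: le_lt_trans (ler_normD _ _) _; rewrite ltrD.
Qed.

Lemma near_box_refl e z : 0 < e -> near_box e z z.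
Proof. by move=> e0 i; rewrite subrr normr0. Qed.

Lemma crd_small_cmod z w e j :
  near_box e z w -> cmod (w 0 j - z 0 j) < e + e.
Proof.
move=> h; apply: le_lt_trans (cmod_le_ReIm _) _.
by rewrite ReB ImB; apply: ltrD; [exact: (h (j, false))|exact: (h (j, true))].
Qed.

Lemma nbhs_boxP z (A : set (Cn R n)) :
  nbhs z A <-> exists2 e : R, 0 < e & forall w, near_box e z w -> A w.
Proof.
split.
  move/nbhs_ballP => [e e0 eA].
  have er : e = (Re e)%:C by rewrite RRe_real// gtr0_real.
  have e0' : 0 < Re e by rewrite -ltcR -er.
  exists (Re e / 2); first by rewrite divr_gt0.
  move=> w wz; apply: eA; split => // i j.
  rewrite (ord1 i) /ball /= /ball_ cmodE er ltcR cmodB [ltRHS](splitr (Re e)).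
  exact: crd_small_cmod.
move=> [e e0 eA]; apply/nbhs_ballP; exists e%:C => /=; first by rewrite ltcR.
move=> w [_ zw]; apply: eA => i; rewrite -crdB.
apply: le_lt_trans (normr_crd_le _ _) _.
have := zw 0 i.1; rewrite /ball /= /ball_ cmodE ltcR !mxE cmodB.
by [].
Qed.

Lemma continuous_boxP u z : {for z, continuous u} <->
  forall e : R, 0 < e ->
    exists2 d : R, 0 < d & forall w, near_box d z w -> `|u w - u z| < e.
Proof.
split=> [/cvgrPdist_lt h e e0|h].
  have /nbhs_boxP[d d0 dh] := h e e0.
  by exists d => // w /dh; rewrite distrC.
have H : forall e : R, 0 < e -> \forall t \near z, `|u z - u t| < e.
  move=> e e0; apply/nbhs_boxP.
  have [d d0 dh] := h e e0.
  by exists d => // w /dh; rewrite distrC.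
by case: (@cvgrPdist_lt R R^o (Cn R n) (nbhs z) (nbhs_filter z) u (u z)) => _; exact.
Qed.

(** Compactness as a choice of scale: with e ranging over the filter of small
    positive numbers, this is the near-covering property of K. *)
Lemma compact_scale (K : set (Cn R n)) (Q : R -> Cn R n -> Prop) :
  compact K ->
  (forall e e' z, 0 < e' -> e' <= e -> Q e z -> Q e' z) ->
  (forall z, K z -> exists2 e : R, 0 < e &
     forall w, near_box e z w -> K w -> Q e w) ->
  exists2 e : R, 0 < e & forall z, K z -> Q e z.
Proof.
move=> /compact_near_coveringP cK Qle Qloc.
have H : \forall e \near (0:R)^'+, K `<=` (fun z => K z -> Q e z).
  apply: cK => z Kz.
  have [e e0 eQ] := Qloc z Kz.
  exists ([set w | near_box e z w], [set t : R | 0 < t < e]) => /=.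
    split; first by apply/nbhs_boxP; exists e.
    near=> t; apply/andP; split; near: t; first exact: nbhs_right_gt.
    exact: nbhs_right_lt.
  move=> [w t] /= [zw /andP[t0 te]] Kw.
  by apply: Qle (eQ w zw Kw) => //; exact: ltW.
have /(@filter_ex _ _ (at_right_proper_filter (0:R))) [e [e0 he]] :
  \forall e \near (0:R)^'+, 0 < e /\ (K `<=` (fun z => K z -> Q e z)).
  near=> e; split; near: e => //; exact: nbhs_right_gt.
by exists e => // z Kz; exact: he.
Unshelve. all: by end_near.
Qed.

End Coordinates.

Section Compactness.
Variables (R : realType) (n : nat).
Implicit Types (z w : Cn R n) (A : set (Cn R n)).

(** The closed square is the continuous image of a product of two real segments. *)
Lemma complex_square_compact (M : R) :
  compact [set x : R[i]^o | `|Re x| <= M /\ `|Im x| <= M].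
Proof.
rewrite (_ : mkset _ =
  (fun xy : R * R => (xy.1 +i* xy.2 : R[i]^o)) @` (`[- M, M] `*` `[- M, M])).
  apply: continuous_compact; last by apply: compact_setX; exact: segment_compact.
  apply: continuous_subspaceT => -[a b] /=.
  apply/cvgrPdist_lt => e e0.
  have er : e = (Re e)%:C by rewrite RRe_real// gtr0_real.
  have e0' : 0 < Re e by rewrite -ltcR -er.
  exists (ball a (Re e / 2), ball b (Re e / 2)) => /=.
    by split; apply: nbhsx_ballx; rewrite divr_gt0.
  move=> [x y] /= [ax ay]; rewrite cmodE er ltcR.
  apply: le_lt_trans (cmod_le_ReIm _) _ => /=.
  by rewrite (splitr (Re e)) ltrD.
apply/seteqP; split => [[a b] /= [ha hb]|x [[a b] /=]].
  by exists (a, b) => //=; rewrite !in_itv /= -!ler_norml.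
by rewrite !in_itv /= -!ler_norml => -[ha hb] <-.
Qed.

Lemma closed_bounded_compact A : closed A -> ebounded A -> compact A.
Proof.
move=> cA [M AM].
apply: (subclosed_compact cA (@rV_compact _ n
  (fun=> [set x : R[i]^o | `|Re x| <= M /\ `|Im x| <= M]) _)).
  by move=> _; exact: complex_square_compact.
move=> z Az /= j.
have zM : cmod (z 0 j) <= M.
  apply: le_trans (AM z Az); rewrite /enorm -[leLHS]ger0_norm ?cmod_ge0//.
  rewrite -sqrtr_sqr ler_wsqrtr// (bigD1 j)//= lerDl sumr_ge0// => k _.
  by rewrite sqr_ge0.
by split; apply: le_trans zM; [exact: normRe_le|exact: normIm_le].
Qed.

Lemma normr_crd_le_enorm z i : `|crd z i| <= enorm z.
Proof.
apply: le_trans (normr_crd_le _ _) _.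
rewrite /enorm -[leLHS]ger0_norm ?cmod_ge0//.
rewrite -sqrtr_sqr ler_wsqrtr// (bigD1 i.1)//= lerDl sumr_ge0// => k _.
by rewrite sqr_ge0.
Qed.

Lemma enorm_le_crd z e : 0 <= e -> (forall i, `|crd z i| <= e) ->
  enorm z <= 2 * n%:R * e.
Proof.
move=> e0 ze.
have ne0 : 0 <= 2 * n%:R * e by rewrite !mulr_ge0.
rewrite /enorm -[leRHS]ger0_norm// -sqrtr_sqr ler_wsqrtr//.
apply: (@le_trans _ _ (\sum_(j < n) (2 * e) ^+ 2)).
  apply: ler_sum => j _; rewrite lerXn2r ?nnegrE ?cmod_ge0 ?mulr_ge0//.
  apply: le_trans (cmod_le_ReIm _) _; rewrite mulr_natl mulr2n.
  by apply: lerD; [exact: (ze (j, false))|exact: (ze (j, true))].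
rewrite sumr_const card_ord -[_ *+ n]mulr_natl.
have -> : (2 * n%:R * e) ^+ 2 = n%:R ^+ 2 * (2 * e) ^+ 2 by ring.
rewrite ler_wpM2r ?sqr_ge0// -natrX ler_nat.
by case: n => // m; rewrite expnS expn1 leq_pmulr.
Qed.

Lemma closure_bounded A : ebounded A -> ebounded (closure A).
Proof.
move=> [M AM]; exists (2 * n%:R * (`|M| + 1)) => z Az.
apply: enorm_le_crd => [|i]; first by rewrite addr_ge0.
have [|w [Aw wz]] := Az [set w | near_box 1 z w].
  by apply/nbhs_boxP; exists 1.
rewrite -(subrK (crd w i) (crd z i)) addrC.
apply: le_trans (ler_normD _ _) _; apply: lerD.
  by apply: le_trans (normr_crd_le_enorm _ _) _; apply: le_trans (AM _ Aw) (ler_norm _).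
by apply: ltW; rewrite distrC; exact: (wz i).
Qed.

Lemma compact_closure A : ebounded A -> compact (closure A).
Proof.
by move=> bA; apply: closed_bounded_compact; [exact: closed_closure|exact: closure_bounded].
Qed.

End Compactness.

(** * Cauchy's estimate in one variable *)

Section ComplexIntegral.
Variable R : realType.
Implicit Types (F G : R -> R[i]) (a b m : R).
Notation mu := (@lebesgue_measure R).

(** The integral of a complex function on a segment, one real integral for each
    part. *)
Definition CI F a b : R[i] :=
  (\int[mu]_(x in `[a, b]) Re (F x)) +i* (\int[mu]_(x in `[a, b]) Im (F x)).

(** Continuity on a closed segment, in the form in which pointwise
    differentiability provides it. *)
Definition path_cont F a b := forall x, a <= x <= b -> forall e : R, 0 < e ->
  exists2 d : R, 0 < d &
    forall y, a <= y <= b -> `|y - x| < d -> cmod (F y - F x) < e.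

Lemma path_contB F G a b :
  path_cont F a b -> path_cont G a b -> path_cont (fun x => F x - G x) a b.
Proof.
move=> hF hG x xab e e0; have e20 : 0 < e / 2 by rewrite divr_gt0.
have [d d0 dh] := hF x xab _ e20; have [d' d'0 d'h] := hG x xab _ e20.
exists (Num.min d d') => [|y yab]; first by rewrite lt_min d0.
rewrite lt_min => /andP[yd yd'].
rewrite (_ : _ - _ = (F y - F x) - (G y - G x)); last by ring.
apply: le_lt_trans (cmodD _ _) _.
by rewrite cmodN (splitr e) ltrD ?dh ?d'h.
Qed.

Lemma path_contZ (c : R[i]) F a b :
  path_cont F a b -> path_cont (fun x => c * F x) a b.
Proof.
move=> hF x xab e e0.
have c0 : 0 < cmod c + 1 by rewrite ltr_wpDl ?cmod_ge0.
have [|d d0 dh] := hF x xab (e / (cmod c + 1)); first by rewrite divr_gt0.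
exists d => // y yab yd; rewrite -mulrBr cmodM.
apply: (@le_lt_trans _ _ ((cmod c + 1) * cmod (F y - F x))).
  by rewrite ler_wpM2r ?cmod_ge0// lerDl.
by rewrite mulrC -ltr_pdivlMr// dh.
Qed.

Lemma path_cont_cst (c : R[i]) a b : path_cont (fun=> c) a b.
Proof. by move=> x _ e e0; exists 1 => // y _ _; rewrite subrr cmod0. Qed.

Lemma within_cont (f : R -> R) a b :
  (forall x, a <= x <= b -> forall e : R, 0 < e -> exists2 d : R, 0 < d &
    forall y, a <= y <= b -> `|y - x| < d -> `|f y - f x| < e) ->
  {within `[a, b], continuous f}.
Proof.
move=> h; apply/subspace_continuousP => x /=; rewrite in_itv /= => xab.
apply/cvgrPdist_lt => e e0.
have [d d0 dh] := h x xab e e0.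
rewrite near_withinE; exists d => //= y yd; rewrite in_itv /= => yab.
by rewrite distrC dh// distrC.
Qed.

Lemma path_cont_Re F a b : path_cont F a b ->
  {within `[a, b], continuous (fun x => Re (F x))}.
Proof.
move=> h; apply: within_cont => x xab e e0; have [d d0 dh] := h x xab e e0.
exists d => // y yab yd; apply: le_lt_trans (dh y yab yd).
by rewrite -ReB normRe_le.
Qed.

Lemma path_cont_Im F a b : path_cont F a b ->
  {within `[a, b], continuous (fun x => Im (F x))}.
Proof.
move=> h; apply: within_cont => x xab e e0; have [d d0 dh] := h x xab e e0.
exists d => // y yab yd; apply: le_lt_trans (dh y yab yd).
by rewrite -ImB normIm_le.
Qed.

Lemma path_cont_int F a b : path_cont F a b ->
  mu.-integrable `[a, b] (EFin \o (fun x => Re (F x))) /\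
  mu.-integrable `[a, b] (EFin \o (fun x => Im (F x))).
Proof.
move=> h; split; apply: continuous_compact_integrable => //.
- exact: segment_compact.
- exact: path_cont_Re.
- exact: segment_compact.
- exact: path_cont_Im.
Qed.

Lemma CI_split F a m b : a <= m -> m <= b -> path_cont F a b ->
  CI F a b = CI F a m + CI F m b.
Proof.
move=> am mb /path_cont_int[iR iI].
have aux (f : R -> R) : mu.-integrable `[a, b] (EFin \o f) ->
  \int[mu]_(x in `[a, b]) f x =
  \int[mu]_(x in `[a, m]) f x + \int[mu]_(x in `[m, b]) f x.
  move=> if_; apply/eqP; rewrite addrC -subr_eq; apply/eqP.
  rewrite Rintegral_itvB ?bnd_simp// Rintegral_itv_obnd_cbnd//.
  apply: integrableS if_ => //; apply: subset_itvr; by rewrite bnd_simp.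
by rewrite /CI aux// (aux (fun x => Im (F x))).
Qed.

Lemma CIB F G a b : path_cont F a b -> path_cont G a b ->
  CI (fun x => F x - G x) a b = CI F a b - CI G a b.
Proof.
move=> /path_cont_int[FR FI] /path_cont_int[GR GI].
apply: complex_ext; rewrite ?(ReB, ImB) /= -RintegralB//;
  by apply: eq_Rintegral => x _; rewrite ?(ReB, ImB).
Qed.

Lemma CIZ (c : R[i]) F a b : path_cont F a b ->
  CI (fun x => c * F x) a b = c * CI F a b.
Proof.
move=> /path_cont_int[FR FI]; case: c => u v.
have ReM (x y : R[i]) : Re (x * y) = Re x * Re y - Im x * Im y by case: x; case: y.
have ImM (x y : R[i]) : Im (x * y) = Re x * Im y + Im x * Re y by case: x; case: y.
have Z (k : R) (f : R -> R) : mu.-integrable `[a, b] (EFin \o f) ->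
    mu.-integrable `[a, b] (EFin \o (fun x => k * f x)).
  by move=> h; apply: (@integrableZl _ _ R mu `[a, b] _ k (EFin \o f) h).
apply: complex_ext; rewrite ?(ReM, ImM) /=.
- rewrite -!RintegralZl// -RintegralB//; [|exact: Z..].
  by apply: eq_Rintegral => x _; rewrite ReM.
- rewrite -!RintegralZl// -RintegralD//; [|exact: Z..].
  by apply: eq_Rintegral => x _; rewrite ImM.
Qed.

Lemma fine_itv a b : a <= b -> fine (mu `[a, b]) = b - a.
Proof.
rewrite le_eqVlt => /predU1P[->|ab].
  by rewrite set_itv1 lebesgue_measure_set1 subrr.
by rewrite lebesgue_measure_itv/= lte_fin ab.
Qed.

Lemma CI_cst (c : R[i]) a b : a <= b -> CI (fun=> c) a b = c * (b - a)%:C.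
Proof.
move=> ab; rewrite /CI !Rintegral_cst// !fine_itv//.
by case: c => u v /=; apply: complex_ext => /=; rewrite !mulr0 ?subr0 ?add0r.
Qed.

Lemma CI_Re_ge F a b k : a <= b -> path_cont F a b ->
  (forall x, a <= x <= b -> k <= Re (F x)) -> k * (b - a) <= Re (CI F a b).
Proof.
move=> ab /path_cont_int[iR _] h /=.
rewrite -fine_itv// -Rintegral_cst//; apply: le_Rintegral => //.
exact: (@path_cont_int (fun=> k%:C) a b (@path_cont_cst _ _ _)).1.
Qed.

Lemma CI_Im_ge F a b k : a <= b -> path_cont F a b ->
  (forall x, a <= x <= b -> k <= Im (F x)) -> k * (b - a) <= Im (CI F a b).
Proof.
move=> ab /path_cont_int[_ iI] h /=.
rewrite -fine_itv// -Rintegral_cst//; apply: le_Rintegral => //.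
exact: (@path_cont_int (fun=> k%:C) a b (@path_cont_cst _ _ _)).1.
Qed.

(** The factor 2 comes from bounding real and imaginary parts separately. *)
Lemma CI_bound F a b M : a <= b -> path_cont F a b ->
  (forall x, a <= x <= b -> cmod (F x) <= M) ->
  cmod (CI F a b) <= 2 * M * (b - a).
Proof.
move=> ab cF FM.
have FM' x : a <= x <= b -> `|Re (F x)| <= M /\ `|Im (F x)| <= M.
  move=> /FM h; split; apply: le_trans h; [exact: normRe_le|exact: normIm_le].
have NF : path_cont (fun x => (-1) * F x) a b by exact: path_contZ.
have N : CI (fun x => (-1) * F x) a b = - CI F a b by rewrite CIZ// mulN1r.
have ReN (x : R[i]) : Re (- x) = - Re x by case: x.
have ImN (x : R[i]) : Im (- x) = - Im x by case: x.
have h1 : - M * (b - a) <= Re (CI F a b).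
  by apply: CI_Re_ge => // x /FM'[]; rewrite ler_norml => /andP[].
have h2 : - M * (b - a) <= Im (CI F a b).
  by apply: CI_Im_ge => // x /FM'[_]; rewrite ler_norml => /andP[].
have h3 : - M * (b - a) <= Re (- CI F a b).
  rewrite -N; apply: CI_Re_ge => // x /FM'[]; rewrite mulN1r ReN lerN2.
  by rewrite ler_norml => /andP[].
have h4 : - M * (b - a) <= Im (- CI F a b).
  rewrite -N; apply: CI_Im_ge => // x /FM'[_]; rewrite mulN1r ImN lerN2.
  by rewrite ler_norml => /andP[].
move: h3 h4; rewrite ReN ImN !mulNr !lerN2 => h3 h4; rewrite mulNr in h1 h2.
apply: le_trans (cmod_le_ReIm _) _.
rewrite -mulrA mulr_natl mulr2n.
by apply: lerD; rewrite ler_norml; apply/andP; split.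
Qed.

End ComplexIntegral.

Section Goursat.
Variable R : realType.
Implicit Types (g h : R[i] -> R[i]) (a b c d x y : R) (z w l : R[i]).

Definition cderive g z l := forall e : R, 0 < e -> exists2 r : R, 0 < r &
  forall w, cmod (w - z) < r -> cmod (g w - g z - l * (w - z)) <= e * cmod (w - z).

Definition cdiff g z := exists l, cderive g z l.

Lemma cdiff_cont g z : cdiff g z -> forall e : R, 0 < e ->
  exists2 r : R, 0 < r & forall w, cmod (w - z) < r -> cmod (g w - g z) < e.
Proof.
move=> [l gl] e e0; have [r r0 rh] := gl 1 ltr01.
have k0 : 0 < cmod l + 1 + 1 by rewrite !ltr_wpDl ?addr_ge0 ?cmod_ge0.
exists (Num.min r (e / (cmod l + 1 + 1))); first by rewrite lt_min r0 divr_gt0.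
move=> w; rewrite lt_min => /andP[/rh h1]; rewrite ltr_pdivlMr// => h2.
rewrite -(subrK (l * (w - z)) (g w - g z)).
apply: le_lt_trans (cmodD _ _) _; rewrite cmodM.
have := cmod_ge0 (w - z); nra.
Qed.

Lemma cmod_hline x y y' : cmod ((x +i* y) - (x +i* y')) = `|y - y'|.
Proof. by rewrite /cmod /= subrr expr0n add0r sqrtr_sqr. Qed.

Lemma cmod_vline x x' y : cmod ((x +i* y) - (x' +i* y)) = `|x - x'|.
Proof. by rewrite /cmod /= subrr expr0n addr0 sqrtr_sqr. Qed.

Definition hedge g y a b := CI (fun x => g (x +i* y)) a b.
Definition vedge g x c d := CI (fun y => g (x +i* y)) c d.

(** The integral of g along the positively oriented boundary of the rectangle
    [a, b] x [c, d]. *)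
Definition contour g a b c d : R[i] :=
  hedge g c a b - hedge g d a b + iC * (vedge g b c d - vedge g a c d).

Lemma hpath_cont g y a b : (forall x, a <= x <= b -> cdiff g (x +i* y)) ->
  path_cont (fun x => g (x +i* y)) a b.
Proof.
move=> gd x /gd gx e e0; have [r r0 rh] := cdiff_cont gx e0.
by exists r => // x' _ xr; apply: rh; rewrite cmod_vline.
Qed.

Lemma vpath_cont g x c d : (forall y, c <= y <= d -> cdiff g (x +i* y)) ->
  path_cont (fun y => g (x +i* y)) c d.
Proof.
move=> gd y /gd gy e e0; have [r r0 rh] := cdiff_cont gy e0.
by exists r => // y' _ yr; apply: rh; rewrite cmod_hline.
Qed.

Lemma nested_intervals (a b : nat -> R) :
  (forall k, a k <= a k.+1) -> (forall k, b k.+1 <= b k) ->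
  (forall k, a k <= b k) -> exists x, forall k, a k <= x <= b k.
Proof.
move=> aS bS ab.
have amono : {homo a : i j / (i <= j)%N >-> i <= j}.
  exact: (@homo_leq _ a <=%R (@lexx _ _) (@le_trans _ _) aS).
have bmono i j : (i <= j)%N -> b j <= b i.
  elim: j => [|j IH]; first by rewrite leqn0 => /eqP->.
  by rewrite leq_eqVlt => /predU1P[->//|/IH]; exact: le_trans.
have ajbk j k : a j <= b k.
  apply: (@le_trans _ _ (a (maxn j k))); first by apply: amono; exact: leq_maxl.
  by apply: le_trans (ab _) _; apply: bmono; exact: leq_maxr.
have ub : has_sup (range a).
  by split; [exists (a 0%N); exists 0%N|exists (b 0%N) => _ [j _ <-]].
exists (sup (range a)) => k; apply/andP; split.
  by apply: (ub_le_sup ub.2); exists k.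
by apply: (ge_sup ub.1) => _ [j _ <-].
Qed.

Definition on_rect g a b c d :=
  forall x y, a <= x <= b -> c <= y <= d -> cdiff g (x +i* y).

Lemma on_rect_sub g a b c d a' b' c' d' :
  a <= a' -> b' <= b -> c <= c' -> d' <= d ->
  on_rect g a b c d -> on_rect g a' b' c' d'.
Proof.
move=> aa bb cc dd h x y /andP[? ?] /andP[? ?]; apply: h; apply/andP; split;
  by [apply: le_trans aa _|apply: le_trans bb|apply: le_trans cc _|apply: le_trans dd].
Qed.

Lemma contour_vsplit g a m b c d : a <= m -> m <= b ->
  path_cont (fun x => g (x +i* c)) a b -> path_cont (fun x => g (x +i* d)) a b ->
  contour g a b c d = contour g a m c d + contour g m b c d.
Proof.
move=> am mb hc hd; rewrite /contour /hedge (CI_split am mb hc) (CI_split am mb hd).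
by ring.
Qed.

Lemma contour_hsplit g a b c m d : c <= m -> m <= d ->
  path_cont (fun y => g (a +i* y)) c d -> path_cont (fun y => g (b +i* y)) c d ->
  contour g a b c d = contour g a b c m + contour g a b m d.
Proof.
move=> cm md ha hb; rewrite /contour /vedge (CI_split cm md ha) (CI_split cm md hb).
by ring.
Qed.

Lemma cmod_iC : cmod iC = 1 :> R.
Proof. by rewrite /cmod /= expr0n add0r expr1n sqrtr1. Qed.

Lemma contour_bound g a b c d M : a <= b -> c <= d ->
  path_cont (fun x => g (x +i* c)) a b -> path_cont (fun x => g (x +i* d)) a b ->
  path_cont (fun y => g (a +i* y)) c d -> path_cont (fun y => g (b +i* y)) c d ->
  (forall x, a <= x <= b -> cmod (g (x +i* c)) <= M /\ cmod (g (x +i* d)) <= M) ->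
  (forall y, c <= y <= d -> cmod (g (a +i* y)) <= M /\ cmod (g (b +i* y)) <= M) ->
  cmod (contour g a b c d) <= 4 * M * ((b - a) + (d - c)).
Proof.
move=> ab cd pc pd pa pb hM vM.
have h1 := CI_bound ab pc (fun x q => (hM x q).1).
have h2 := CI_bound ab pd (fun x q => (hM x q).2).
have h3 := CI_bound cd pa (fun x q => (vM x q).1).
have h4 := CI_bound cd pb (fun x q => (vM x q).2).
apply: le_trans (cmodD _ _) _; rewrite cmodM cmod_iC mul1r.
apply: le_trans (lerD (cmodD _ _) (cmodD _ _)) _; rewrite !cmodN.
rewrite -/(hedge _ _ _ _) -/(vedge _ _ _ _) in h1 h2 h3 h4.
by lra.
Qed.

(** Opposite sides contribute constants for an affine map, so that no primitive
    has to be computed. *)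
Lemma contour_affine (k l z : R[i]) a b c d : a <= b -> c <= d ->
  contour (fun w => k + l * (w - z)) a b c d = 0.
Proof.
move=> ab cd.
have cl u v : path_cont (fun x : R => k + l * ((x +i* u) - z)) v b.
  apply: (@hpath_cont (fun w => k + l * (w - z))) => x _; exists l => e e0.
  exists 1 => // w _; rewrite (_ : _ - _ - _ = 0) ?cmod0 ?mulr_ge0 ?cmod_ge0 ?ltW//.
  by ring.
have cl' u v : path_cont (fun y : R => k + l * ((u +i* y) - z)) v d.
  apply: (@vpath_cont (fun w => k + l * (w - z))) => x _; exists l => e e0.
  exists 1 => // w _; rewrite (_ : _ - _ - _ = 0) ?cmod0 ?mulr_ge0 ?cmod_ge0 ?ltW//.
  by ring.
rewrite /contour /hedge /vedge -CIB// -CIB//.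
rewrite (_ : (fun x : R => _ - _) = (fun=> l * (0 +i* (c - d)))); last first.
  apply/funext => x; rewrite (_ : 0 +i* (c - d) = (x +i* c) - (x +i* d)); first by ring.
  by apply: complex_ext; rewrite /= ?subrr.
rewrite (_ : (fun y : R => k + l * ((b +i* y) - z) - _) = (fun=> l * ((b - a) +i* 0))); last first.
  apply/funext => y; rewrite (_ : (b - a) +i* 0 = (b +i* y) - (a +i* y)); first by ring.
  by apply: complex_ext; rewrite /= ?subrr.
rewrite !CI_cst//.
transitivity (l * ((0 +i* (c - d)) * (b - a)%:C + iC * (((b - a) +i* 0) * (d - c)%:C))).
  by ring.
rewrite (_ : _ + _ = 0) ?mulr0//.
by apply: complex_ext => /=; ring.
Qed.

Lemma contourB g h a b c d :
  path_cont (fun x => g (x +i* c)) a b -> path_cont (fun x => g (x +i* d)) a b ->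
  path_cont (fun y => g (a +i* y)) c d -> path_cont (fun y => g (b +i* y)) c d ->
  path_cont (fun x => h (x +i* c)) a b -> path_cont (fun x => h (x +i* d)) a b ->
  path_cont (fun y => h (a +i* y)) c d -> path_cont (fun y => h (b +i* y)) c d ->
  contour (fun w => g w - h w) a b c d = contour g a b c d - contour h a b c d.
Proof.
by move=> *; rewrite /contour /hedge /vedge !CIB//; ring.
Qed.

Lemma contourZ (k : R[i]) g a b c d :
  path_cont (fun x => g (x +i* c)) a b -> path_cont (fun x => g (x +i* d)) a b ->
  path_cont (fun y => g (a +i* y)) c d -> path_cont (fun y => g (b +i* y)) c d ->
  contour (fun w => k * g w) a b c d = k * contour g a b c d.
Proof.
by move=> *; rewrite /contour /hedge /vedge !CIZ//; ring.
Qed.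

(** The affine part of g at z integrates to 0, and what remains is negligible with
    respect to the distance to z. *)
Lemma contour_small g z e : 0 < e -> cdiff g z -> exists2 r : R, 0 < r &
  forall a b c d, a <= Re z <= b -> c <= Im z <= d ->
    (b - a) + (d - c) < r -> on_rect g a b c d ->
    cmod (contour g a b c d) <= e * ((b - a) + (d - c)) ^+ 2.
Proof.
move=> e0 [l gl]; have e40 : 0 < e / 4 by rewrite divr_gt0.
have [r r0 rh] := gl _ e40; exists r => // a b c d /andP[az zb] /andP[cz zd] sr grect.
have ab : a <= b by apply: le_trans zb.
have cd : c <= d by apply: le_trans zd.
pose A w := g z + l * (w - z).
have Ad w : cdiff A w.
  exists l => e' e'0; exists 1 => // w' _.
  rewrite (_ : _ - _ - _ = 0) ?cmod0 ?mulr_ge0 ?cmod_ge0 ?ltW//.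
  by rewrite /A; ring.
have gp u : c <= u <= d -> path_cont (fun x => g (x +i* u)) a b.
  by move=> uh; apply: hpath_cont => x xh; exact: grect.
have gq u : a <= u <= b -> path_cont (fun y => g (u +i* y)) c d.
  by move=> uh; apply: vpath_cont => x xh; exact: grect.
have Ap u : path_cont (fun x => A (x +i* u)) a b by apply: hpath_cont.
have Aq u : path_cont (fun x => A (u +i* x)) c d by apply: vpath_cont.
set s := (b - a) + (d - c) in sr *.
have err x y : a <= x <= b -> c <= y <= d ->
    cmod (g (x +i* y) - A (x +i* y)) <= e / 4 * s.
  move=> xab ycd.
  have dist : cmod ((x +i* y) - z) <= s.
    apply: le_trans (cmod_le_ReIm _) _; rewrite ReB ImB /= /s.
    move/andP: xab => [? ?]; move/andP: ycd => [? ?].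
    by apply: lerD; rewrite ler_norml; apply/andP; split; lra.
  rewrite /A opprD addrA; apply: (le_trans (rh _ (le_lt_trans dist sr))).
  by rewrite ler_wpM2l// ltW.
have caa : c <= c <= d by rewrite lexx.
have cdd : c <= d <= d by rewrite lexx cd.
have aab : a <= a <= b by rewrite lexx.
have abb : a <= b <= b by rewrite lexx ab.
have -> : contour g a b c d = contour (fun w => g w - A w) a b c d.
  by rewrite contourB; [rewrite contour_affine// subr0|exact: gp|exact: gp|exact: gq|exact: gq|..].
have -> : e * s ^+ 2 = 4 * (e / 4 * s) * s by field.
apply: contour_bound => //.
- by apply: path_contB => //; exact: gp.
- by apply: path_contB => //; exact: gp.
- by apply: path_contB => //; exact: gq.
- by apply: path_contB => //; exact: gq.
- by move=> x xh; split; exact: err.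
- by move=> y yh; split; exact: err.
Qed.

End Goursat.

Section CauchyEstimate.
Variable R : realType.
Implicit Types (g h : R[i] -> R[i]) (a b c d x y : R) (z w l : R[i]).

Lemma pow2_small (s r : R) : 0 <= s -> 0 < r -> exists k, s / 2 ^+ k < r.
Proof.
move=> s0 r0; exists (Num.bound (s / r)).
have h : s / r < (Num.bound (s / r))%:R.
  by apply: le_lt_trans (archi_boundP _); [exact: lexx|rewrite divr_ge0// ltW].
rewrite ltr_pdivrMr ?exprn_gt0// mulrC -ltr_pdivrMr//.
by apply: (lt_trans h); rewrite -natrX ltr_nat ltn_expl.
Qed.

Let bad g e (q : (R * R) * (R * R)) :=
  [/\ q.1.1 <= q.1.2, q.2.1 <= q.2.2, on_rect g q.1.1 q.1.2 q.2.1 q.2.2 &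
     e * ((q.1.2 - q.1.1) + (q.2.2 - q.2.1)) ^+ 2
       < cmod (contour g q.1.1 q.1.2 q.2.1 q.2.2)].

Let half (q q' : (R * R) * (R * R)) :=
  [/\ q.1.1 <= q'.1.1 /\ q'.1.2 <= q.1.2, q.2.1 <= q'.2.1 /\ q'.2.2 <= q.2.2,
      q'.1.2 - q'.1.1 = (q.1.2 - q.1.1) / 2 &
      q'.2.2 - q'.2.1 = (q.2.2 - q.2.1) / 2].

(** The contour integral is the sum over the four quarters, and the square of the
    size is divided by 4, so one quarter is as bad as the whole rectangle. *)
Lemma bad_half g e q : bad g e q -> exists q', bad g e q' /\ half q q'.
Proof.
case: q => -[a b] [c d] [/= ab cd gr big].
pose m := (a + b) / 2; pose n := (c + d) / 2.
have am : a <= m by rewrite /m; lra.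
have mb : m <= b by rewrite /m; lra.
have cn : c <= n by rewrite /n; lra.
have nd : n <= d by rewrite /n; lra.
have ma : m - a = (b - a) / 2 by rewrite /m; field.
have bm : b - m = (b - a) / 2 by rewrite /m; field.
have nc : n - c = (d - c) / 2 by rewrite /n; field.
have dn : d - n = (d - c) / 2 by rewrite /n; field.
have ab2 : 0 <= (b - a) / 2 by lra.
have cd2 : 0 <= (d - c) / 2 by lra.
have hp u : c <= u <= d -> path_cont (fun x => g (x +i* u)) a b.
  by move=> uh; apply: hpath_cont => x xh; exact: gr.
have vp u : a <= u <= b -> path_cont (fun y => g (u +i* y)) c d.
  by move=> uh; apply: vpath_cont => x xh; exact: gr.
have E : contour g a b c d =
  (contour g a m c n + contour g m b c n) + (contour g a m n d + contour g m b n d).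
  rewrite (@contour_hsplit _ _ a b c n d)//; [|apply: vp; lra..].
  by rewrite !(@contour_vsplit _ _ a m b)//; apply: hp; lra.
apply: contrapT => /forallNP no.
have small a' b' c' d' : a <= a' -> b' <= b -> c <= c' -> d' <= d ->
    b' - a' = (b - a) / 2 -> d' - c' = (d - c) / 2 ->
    cmod (contour g a' b' c' d') <= e * (((b - a) + (d - c)) / 2) ^+ 2.
  move=> h1 h2 h3 h4 h5 h6; rewrite leNgt; apply/negP => big'.
  apply: (no ((a', b'), (c', d'))); split => //; split => /=.
  - by rewrite -subr_ge0 h5.
  - by rewrite -subr_ge0 h6.
  - exact: on_rect_sub gr.
  - by rewrite h5 h6 -mulrDl.
have h4 := small a m c n (lexx _) mb (lexx _) nd ma nc.
have h3 := small m b c n am (lexx _) (lexx _) nd bm nc.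
have h2 := small a m n d (lexx _) mb cn (lexx _) ma dn.
have h1 := small m b n d am (lexx _) cn (lexx _) bm dn.
suff : cmod (contour g a b c d) <= e * ((b - a) + (d - c)) ^+ 2 by rewrite leNgt big.
rewrite E.
apply: le_trans (cmodD _ _) _; apply: le_trans (lerD (cmodD _ _) (cmodD _ _)) _.
apply: le_trans (lerD (lerD h4 h3) (lerD h2 h1)) _.
by rewrite le_eqVlt; apply/orP; left; apply/eqP; field.
Qed.

(** Goursat's lemma, by bisection: complex differentiability at each point,
    without continuity of the derivative, is enough. *)
Lemma goursat g a b c d : a <= b -> c <= d -> on_rect g a b c d ->
  contour g a b c d = 0.
Proof.
move=> ab cd gr; apply: cmod_eq0; apply/eqP; rewrite eq_le cmod_ge0 andbT leNgt.
apply/negP; set M := cmod _ => M0; pose s := (b - a) + (d - c).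
have s0 : 0 <= s by rewrite /s; lra.
have s20 : 0 < s ^+ 2 + 1 by rewrite ltr_wpDl ?sqr_ge0.
(* small enough for the whole rectangle to violate the estimate of
   [contour_small]; the 1 avoids a division by 0 when s = 0 *)
pose e := M / 2 / (s ^+ 2 + 1).
have e0 : 0 < e by rewrite !divr_gt0.
have bad0 : bad g e ((a, b), (c, d)).
  split => //=; rewrite -/s -/M /e mulrAC ltr_pdivrMr//.
  have aux (N t : R) : 0 < N -> 0 <= t -> N / 2 * t < N * (t + 1) by nra.
  by rewrite aux ?sqr_ge0.
have [F HF] : exists F, forall q, bad g e q -> bad g e (F q) /\ half q (F q).
  suff /choice[F hF] : forall q, exists q', bad g e q -> bad g e q' /\ half q q'.
    by exists F.
  move=> q.
  have [bq|nbq] := pselect (bad g e q); last by exists q.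
  by have [q' h] := bad_half bq; exists q'.
pose Q k := iter k F ((a, b), (c, d)).
have badQ k : bad g e (Q k) by elim: k => //= k /HF[].
have halfQ k : half (Q k) (Q k.+1) by have [] := HF _ (badQ k).
have [x xQ] : exists x, forall k, (Q k).1.1 <= x <= (Q k).1.2.
  apply: nested_intervals => k; first by case: (halfQ k) => -[].
    by case: (halfQ k) => -[].
  by case: (badQ k).
have [y yQ] : exists y, forall k, (Q k).2.1 <= y <= (Q k).2.2.
  apply: nested_intervals => k; first by case: (halfQ k) => _ [].
    by case: (halfQ k) => _ [].
  by case: (badQ k).
have sQ k : ((Q k).1.2 - (Q k).1.1) + ((Q k).2.2 - (Q k).2.1) = s / 2 ^+ k.
  elim: k => [|k IH]; first by rewrite expr0 divr1.
  by case: (halfQ k) => _ _ -> ->; rewrite -mulrDl IH exprSr invfM mulrA.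
have gz : cdiff g (x +i* y) by apply: gr; [exact: (xQ 0%N)|exact: (yQ 0%N)].
have [r r0 rh] := contour_small e0 gz.
have [k kr] := pow2_small s0 r0.
have [? ? grk bigk] := badQ k.
have := rh _ _ _ _ (xQ k) (yQ k) _ grk; rewrite sQ => /(_ kr).
by rewrite leNgt -(sQ k) bigk.
Qed.

(** An isolated singularity of size o(1/|z|) does not contribute: the contour can
    be shrunk to the singularity, as the region between two concentric squares
    is a union of four rectangles. *)
Lemma contour_punctured h (r : R) : 0 < r ->
  (forall w, w != 0 -> `|Re w| <= r -> `|Im w| <= r -> cdiff h w) ->
  (forall e : R, 0 < e -> exists2 d : R, 0 < d &
     forall w, w != 0 -> cmod w < d -> cmod (h w) * cmod w <= e) ->
  contour h (- r) r (- r) r = 0.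
Proof.
move=> r0 hd ho; apply: cmod_eq0; apply/eqP; rewrite eq_le cmod_ge0 andbT.
apply/ler_addgt0Pr => e e0; rewrite add0r.
have [|d d0 dh] := ho (e / 16); first by rewrite divr_gt0.
(* points of the square of half-side s have modulus at most 2s < d *)
pose s := Num.min r (d / 3).
have s0 : 0 < s by rewrite lt_min r0 divr_gt0.
have sr : s <= r by rewrite ge_min lexx.
have sd : s <= d / 3 by rewrite ge_min lexx orbT.
have nz x y : s <= `|x| \/ s <= `|y| -> (x +i* y) != 0.
  move=> xy; apply/negP => /eqP[x0 y0]; move: xy; rewrite x0 y0 normr0.
  by case; lra.
have hp u x1 x2 : s <= `|u| -> `|u| <= r -> - r <= x1 -> x2 <= r ->
    path_cont (fun x => h (x +i* u)) x1 x2.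
  move=> su ur rx xr; apply: hpath_cont => x xh; apply: hd => //=.
    by apply: nz; right.
  by rewrite ler_norml; lra.
have vp u x1 x2 : s <= `|u| -> `|u| <= r -> - r <= x1 -> x2 <= r ->
    path_cont (fun x => h (u +i* x)) x1 x2.
  move=> su ur rx xr; apply: vpath_cont => x xh; apply: hd => //=.
    by apply: nz; left.
  by rewrite ler_norml; lra.
have nr : `|r| = r by rewrite gtr0_norm.
have ns : `|s| = s by rewrite gtr0_norm.
have nNr : `|- r| = r by rewrite normrN.
have nNs : `|- s| = s by rewrite normrN.
have -> : contour h (- r) r (- r) r = contour h (- s) s (- s) s.
  rewrite (@contour_vsplit _ _ (- r) (- s) r); [|lra|lra|apply: hp; lra..].
  rewrite (@contour_vsplit _ _ (- s) s r); [|lra|lra|apply: hp; lra..].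
  rewrite (@contour_hsplit _ _ (- s) s (- r) (- s) r); [|lra|lra|apply: vp; lra..].
  rewrite (@contour_hsplit _ _ (- s) s (- s) s r); [|lra|lra|apply: vp; lra..].
  rewrite (@goursat h (- r) (- s)); [|lra|lra|].
    rewrite (@goursat h s r); [|lra|lra|].
      rewrite (@goursat h (- s) s (- r)); [|lra|lra|].
        rewrite (@goursat h (- s) s s r); [by ring|lra|lra|].
        move=> x y xh yh; apply: hd => /=; rewrite ?ler_norml; try lra.
        by apply: nz; right; rewrite ger0_norm; lra.
      move=> x y xh yh; apply: hd => /=; rewrite ?ler_norml; try lra.
      by apply: nz; right; rewrite ler0_norm; lra.
    move=> x y xh yh; apply: hd => /=; rewrite ?ler_norml; try lra.
    by apply: nz; left; rewrite ger0_norm; lra.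
  move=> x y xh yh; apply: hd => /=; rewrite ?ler_norml; try lra.
  by apply: nz; left; rewrite ler0_norm; lra.
have key x y : `|x| <= s -> `|y| <= s -> s <= `|x| \/ s <= `|y| ->
    cmod (h (x +i* y)) <= e / 16 / s.
  move=> xs ys xys; rewrite ler_pdivlMr//.
  have w0 := nz _ _ xys.
  have ws : s <= cmod (x +i* y).
    by case: xys => h'; apply: (le_trans h');
      [exact: (normRe_le (x +i* y))|exact: (normIm_le (x +i* y))].
  apply: (@le_trans _ _ (cmod (h (x +i* y)) * cmod (x +i* y))).
    by rewrite ler_wpM2l// cmod_ge0.
  apply: dh => //; apply: le_lt_trans (cmod_le_ReIm _) _ => /=.
  by lra.
have -> : e = 4 * (e / 16 / s) * ((s - - s) + (s - - s)).
  by field; rewrite gt_eqF.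
have NsS : - s <= s by rewrite ge0_cp// ltW.
have Nrs : - r <= - s by rewrite lerN2.
apply: contour_bound => //; [apply: hp|apply: hp|apply: vp|apply: vp|..];
  rewrite ?nNs ?ns ?lexx//.
- move=> x xh; have xs : `|x| <= s by rewrite ler_norml.
  by split; apply: key; rewrite ?nNs ?ns//; right.
- move=> x xh; have xs : `|x| <= s by rewrite ler_norml.
  by split; apply: key; rewrite ?nNs ?ns//; left.
Qed.

End CauchyEstimate.

Section ComplexDerivable.
Variable R : realType.
Implicit Types (g h : R[i] -> R[i]) (z w l : R[i]).

Lemma pos_complexP (e : R[i]) : 0 < e -> e = (Re e)%:C /\ 0 < Re e.
Proof.
move=> e0; have er : e = (Re e)%:C by rewrite RRe_real// gtr0_real.
by split => //; rewrite -ltcR -er.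
Qed.

Lemma derivable_cdiff g z : derivable (g : R[i]^o -> R[i]^o) z 1 -> cdiff g z.
Proof.
move=> /cvg_ex[/= l gd]; exists l => e e0.
have e0' : (0 : R[i]) < e%:C by rewrite ltcR.
move/cvgrPdist_le : gd => /(_ _ e0') [r /= r0 rh].
have [rE r0'] := pos_complexP r0.
exists (Re r) => // w wr.
have [->|wz] := eqVneq w z; first by rewrite !subrr mulr0 subr0 cmod0 mulr0.
have wz0 : w - z != 0 by rewrite subr_eq0.
have := rh (w - z); rewrite /ball_ /= sub0r normrN cmodE rE ltcR => /(_ wr wz0).
rewrite cmodE lecR -/l [_ *: 1]mulr1 subrK => lh.
rewrite -[X in cmod X]opprK cmodN opprB.
have -> : l * (w - z) - (g w - g z) = (l - (w - z)^-1 *: (g w - g z)) * (w - z).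
  by rewrite /GRing.scale /= mulrBl mulrAC mulVf// mul1r.
by rewrite cmodM ler_wpM2r// cmod_ge0.
Qed.

Lemma cdiff_derivable g z : cdiff g z -> derivable (g : R[i]^o -> R[i]^o) z 1.
Proof.
move=> [l gl]; apply/cvg_ex; exists l; apply/cvgrPdist_le => e0 e0p.
have [eE ep] := pos_complexP e0p.
have [r r0 rh] := gl _ ep.
exists r%:C => /=; first by rewrite ltcR.
move=> k; rewrite /ball_ /= sub0r normrN cmodE ltcR => kr k0.
rewrite cmodE eE lecR [_ *: 1]mulr1.
have := rh (k + z); rewrite addrK => /(_ kr) kh.
rewrite -(@ler_pM2r _ (cmod k)) ?cmod_gt0// -cmodM -[X in cmod X]opprK cmodN.
rewrite (_ : - _ = g (k + z) - g z - l * k)//.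
by rewrite mulrBl /GRing.scale /= mulrAC mulVf// mul1r opprB.
Qed.

Lemma cdiff_cst (k : R[i]) z : cdiff (fun=> k) z.
Proof. by apply: derivable_cdiff; exact: derivable_cst. Qed.

Lemma cdiffB g h z : cdiff g z -> cdiff h z -> cdiff (fun w => g w - h w) z.
Proof.
move=> /cdiff_derivable dg /cdiff_derivable dh; apply: derivable_cdiff.
exact: (@derivableB _ _ _ (g : R[i]^o -> R[i]^o) (h : R[i]^o -> R[i]^o) z 1 dg dh).
Qed.

Lemma cdiffM g h z : cdiff g z -> cdiff h z -> cdiff (fun w => g w * h w) z.
Proof.
move=> /cdiff_derivable dg /cdiff_derivable dh; apply: derivable_cdiff.
exact: (@derivableM _ _ (g : R[i]^o -> R[i]) (h : R[i]^o -> R[i]) z 1 dg dh).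
Qed.

Lemma cdiffV z : z != 0 -> cdiff (fun w => w^-1) z.
Proof.
move=> z0; apply: derivable_cdiff; exact: derivableV.
Qed.

Lemma cderive_shift g z w l :
  cderive g (z + w) l -> cderive (fun v => g (z + v)) w l.
Proof.
move=> gl e /gl[r r0 rh]; exists r => // v vr.
have := rh (z + v); rewrite (_ : z + v - (z + w) = v - w); last by ring.
exact.
Qed.

Lemma is_derive_eps (f : R -> R) (x l : R) :
  (forall e : R, 0 < e -> exists2 d : R, 0 < d & forall y, `|y - x| < d ->
     `|f y - f x - l * (y - x)| <= e * `|y - x|) ->
  is_derive x 1 f l.
Proof.
move=> h.
have H : (fun k => k^-1 *: ((f \o shift x) (k *: 1) - f x)) @ 0^' --> l.
  apply/cvgrPdist_le => e e0; have [d d0 dh] := h e e0.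
  exists d => //= k; rewrite /ball_ /= sub0r normrN => kd k0.
  rewrite [_ *: 1]mulr1.
  have := dh (k + x); rewrite addrK => /(_ kd) kh.
  rewrite -(@ler_pM2r _ `|k|) ?normr_gt0// -normrM -normrN.
  rewrite (_ : - ((l - _) * k) = f (k + x) - f x - l * k)//.
  by rewrite mulrBl /GRing.scale /= mulrAC mulVf// mul1r opprB.
apply: DeriveDef; first by apply/cvg_ex; exists l.
exact: cvg_lim.
Qed.

Lemma inv_square_cont (r : R) : 0 < r ->
  (forall u a b, `|u| = r -> path_cont (fun x => ((x +i* u) : R[i])^-1) a b) /\
  (forall u a b, `|u| = r -> path_cont (fun x => ((u +i* x) : R[i])^-1) a b).
Proof.
move=> r0; split=> u a b ur.
- apply: (@hpath_cont _ (fun w => w^-1)) => x _; apply: cdiffV.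
  by apply/negP => /eqP[_ u0]; move: ur; rewrite u0 normr0; lra.
- apply: (@vpath_cont _ (fun w => w^-1)) => x _; apply: cdiffV.
  by apply/negP => /eqP[u0 _]; move: ur; rewrite u0 normr0; lra.
Qed.

Lemma ReV (a b : R) : Re ((a +i* b)^-1) = a / (a ^+ 2 + b ^+ 2). Proof. by []. Qed.
Lemma ImV (a b : R) : Im ((a +i* b)^-1) = - (b / (a ^+ 2 + b ^+ 2)). Proof. by []. Qed.

(** The exact value is 2 pi i. Each pair of opposite sides contributes the integral
    of 2r/(x^2 + r^2) over [-r, r], whose integrand is at least 1/r. *)
Lemma contour_inv_lower (r : R) : 0 < r ->
  4 <= cmod (contour (fun w : R[i] => w^-1) (- r) r (- r) r).
Proof.
move=> r0; apply: le_trans (normIm_le _); apply: le_trans (ler_norm _).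
have [hc vc] := inv_square_cont r0.
have nr : `|r| = r by rewrite gtr0_norm.
have nNr : `|- r| = r by rewrite normrN.
rewrite /contour /hedge /vedge -(CIB (hc _ _ _ nNr) (hc _ _ _ nr)).
rewrite -(CIB (vc _ _ _ nr) (vc _ _ _ nNr)).
set X := CI _ _ _; set Y := CI _ _ _.
have -> : Im (X + iC * Y) = Im X + Re Y.
  by case: X; case: Y => ? ? ? ? /=; ring.
have k0 x : - r <= x <= r -> r^-1 / 2 <= r / (x ^+ 2 + r ^+ 2).
  move=> xr; have x2 : x ^+ 2 <= r ^+ 2 by nra.
  have r20 : 0 < r ^+ 2 by rewrite exprn_gt0.
  have s0 : 0 < x ^+ 2 + r ^+ 2 by have := sqr_ge0 x; lra.
  rewrite ler_pdivlMr// -ler_pdivlMl ?divr_gt0 ?invr_gt0//.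
  rewrite invf_div invrK.
  have -> : 2 * r * r = r ^+ 2 + r ^+ 2 by ring.
  lra.
have hX : r^-1 * (r - - r) <= Im X.
  apply: CI_Im_ge; [lra|by apply: path_contB; apply: hc|].
  move=> x xh; rewrite ImB !ImV sqrrN.
  by have := k0 x xh; rewrite mulNr; lra.
have hY : r^-1 * (r - - r) <= Re Y.
  apply: CI_Re_ge; [lra|by apply: path_contB; apply: vc|].
  move=> x xh; rewrite ReB !ReV sqrrN addrC (addrC (r ^+ 2)).
  by have := k0 x xh; rewrite mulNr; lra.
apply: le_trans (lerD hX hY); rewrite opprK -mulr2n -[r + r]mulr2n.
by rewrite -[X in _ * X]mulr_natr mulrA mulVf ?gt_eqF// mul1r; lra.
Qed.

(** Cauchy's estimate for the derivative at the centre of a square. The kernel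
    1/w^2 would have a non-integrable singularity; subtracting l/w leaves a
    remainder of size o(1/|w|), which does not contribute. *)
Lemma cauchy_estimate g z (r M : R) l : 0 < r ->
  (forall w, `|Re (w - z)| <= r -> `|Im (w - z)| <= r ->
     cdiff g w /\ cmod (g w) <= M) ->
  cderive g z l -> cmod l <= 8 * M / r.
Proof.
move=> r0 gM gl.
have M0 : 0 <= M.
  by apply: le_trans (cmod_ge0 _) (gM z _ _).2; rewrite subrr normr0 ltW.
pose k w := (g (z + w) - g z) * (w^-1 * w^-1).
pose h w := k w - l * w^-1.
have gz w : `|Re w| <= r -> `|Im w| <= r ->
    cdiff (fun v => g (z + v)) w /\ cmod (g (z + w)) <= M.
  move=> w1 w2; have [[l' gl'] gw] := gM (z + w) ltac:(by rewrite addrC addKr) ltac:(by rewrite addrC addKr).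
  by split => //; exists l'; exact: cderive_shift.
have kd w : w != 0 -> `|Re w| <= r -> `|Im w| <= r -> cdiff k w.
  move=> w0 w1 w2; apply: cdiffM.
    by apply: cdiffB; [exact: (gz w w1 w2).1|exact: cdiff_cst].
  by apply: cdiffM; exact: cdiffV.
have id w : w != 0 -> cdiff (fun w => l * w^-1) w.
  by move=> w0; apply: cdiffM; [exact: cdiff_cst|exact: cdiffV].
have hd w : w != 0 -> `|Re w| <= r -> `|Im w| <= r -> cdiff h w.
  by move=> w0 w1 w2; apply: cdiffB; [exact: kd|exact: id].
have h0 : contour h (- r) r (- r) r = 0.
  apply: contour_punctured => // e e0; have [d d0 dh] := gl e e0.
  exists d => // w w0 wd; have := dh (z + w); rewrite addrC addKr => /(_ wd) H.
  rewrite -cmodM.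
  rewrite (_ : h w * w = (g (z + w) - g z - l * w) / w); last first.
    rewrite /h /k; field; exact: w0.
  by rewrite cmodM cmodV ler_pdivrMr ?cmod_gt0.
have nr : `|r| = r by rewrite gtr0_norm.
have nNr : `|- r| = r by rewrite normrN.
have nz x u : `|u| = r -> (x +i* u != 0 :> R[i]) /\ (u +i* x != 0 :> R[i]).
  move=> ur; split; apply/negP => /eqP[].
    by move=> _ u0; move: ur; rewrite u0 normr0; lra.
  by move=> u0 _; move: ur; rewrite u0 normr0; lra.
have bd x : - r <= x <= r -> `|x| <= r by rewrite ler_norml.
have kh u : `|u| = r -> path_cont (fun x => k (x +i* u)) (- r) r.
  move=> ur; apply: hpath_cont => x xr; apply: kd; rewrite ?ur//=.
    by have [] := nz x u ur.
  exact: bd.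
have kv u : `|u| = r -> path_cont (fun x => k (u +i* x)) (- r) r.
  move=> ur; apply: vpath_cont => x xr; apply: kd; rewrite ?ur//=.
    by have [] := nz x u ur.
  exact: bd.
have [ih iv] := inv_square_cont r0.
have ih' u : `|u| = r -> path_cont (fun x => l * (x +i* u)^-1) (- r) r.
  by move=> ur; apply: path_contZ; exact: ih.
have iv' u : `|u| = r -> path_cont (fun x => l * (u +i* x)^-1) (- r) r.
  by move=> ur; apply: path_contZ; exact: iv.
have E : l * contour (fun w => w^-1) (- r) r (- r) r = contour k (- r) r (- r) r.
  have := h0; rewrite /h (contourB (kh _ nNr) (kh _ nr) (kv _ nNr) (kv _ nr)
    (ih' _ nNr) (ih' _ nr) (iv' _ nNr) (iv' _ nr)).
  rewrite (contourZ l (ih _ _ _ nNr) (ih _ _ _ nr) (iv _ _ _ nNr) (iv _ _ _ nr)).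
  by move/eqP; rewrite subr_eq0 => /eqP.
have kM w : r <= cmod w -> `|Re w| <= r -> `|Im w| <= r -> cmod (k w) <= 2 * M / r ^+ 2.
  move=> rw w1 w2; rewrite /k cmodM -invfM -expr2 cmodV cmodX.
  have gzM : cmod (g z) <= M by apply: (gM z _ _).2; rewrite subrr normr0 ltW.
  apply: ler_pM; rewrite ?cmod_ge0 ?invr_ge0 ?exprn_ge0 ?cmod_ge0//.
    apply: le_trans (cmodD _ _) _; rewrite cmodN mulr_natl mulr2n lerD//.
    by have [] := gz w w1 w2.
  have cw0 : 0 < cmod w by apply: lt_le_trans rw.
  by rewrite lef_pV2 ?posrE ?exprn_gt0// lerXn2r ?nnegrE ?cmod_ge0// ltW.
have B : cmod (contour k (- r) r (- r) r) <= 4 * (2 * M / r ^+ 2) * ((r - - r) + (r - - r)).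
  have NrR : - r <= r by rewrite ge0_cp// ltW.
  apply: contour_bound => //; try by [apply: kh|apply: kv].
  - move=> x xr; split; apply: kM; rewrite /= ?nr ?nNr ?bd//.
      by have := normIm_le (x +i* (- r)); rewrite /= nNr.
    by have := normIm_le (x +i* r); rewrite /= nr.
  - move=> x xr; split; apply: kM; rewrite /= ?nr ?nNr ?bd//.
      by have := normRe_le ((- r) +i* x); rewrite /= nNr.
    by have := normRe_le (r +i* x); rewrite /= nr.
have L := contour_inv_lower r0.
have : 4 * cmod l <= 4 * (2 * M / r ^+ 2) * ((r - - r) + (r - - r)).
  by apply: le_trans B; rewrite -E cmodM mulrC ler_wpM2l// cmod_ge0.
move=> H; rewrite -(@ler_pM2l _ 4)//; apply: le_trans H _.
by rewrite le_eqVlt; apply/orP; left; apply/eqP; field; rewrite gt_eqF.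
Qed.

(** Every point of the segment from z to z + v is the centre of a square of
    half-side r/2 on which Cauchy's estimate applies; the mean value theorem is then
    used for the real and imaginary parts separately. *)
Lemma bounded_cdiff_lipschitz g z (r M : R) : 0 < r ->
  (forall w, `|Re (w - z)| <= r -> `|Im (w - z)| <= r ->
     cdiff g w /\ cmod (g w) <= M) ->
  forall v, `|Re v| <= r / 2 -> `|Im v| <= r / 2 ->
    cmod (g (z + v) - g z) <= 32 * M / r * cmod v.
Proof.
move=> r0 gM v v1 v2.
have r20 : 0 < r / 2 by rewrite divr_gt0.
have dM (t : R) : 0 <= t <= 1 ->
    exists2 l, cderive g (z + t%:C * v) l & cmod l <= 16 * M / r.
  move=> t01.
  have ReT : Re (t%:C * v) = t * Re v by case: v {v1 v2} => ? ? /=; ring.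
  have ImT : Im (t%:C * v) = t * Im v by case: v {v1 v2 ReT} => ? ? /=; ring.
  have [t0 t1] := andP t01.
  have tv (x : R) : `|x| <= r / 2 -> `|t * x| <= r / 2.
    move=> xr; rewrite normrM ger0_norm//; apply: le_trans xr.
    by rewrite ler_piMl.
  have [||[l gl] _] := gM (z + t%:C * v).
  - by rewrite addrC addKr ReT (le_trans (tv _ v1))//; lra.
  - by rewrite addrC addKr ImT (le_trans (tv _ v2))//; lra.
  exists l => //.
  have -> : 16 * M / r = 8 * M / (r / 2) by field; rewrite gt_eqF.
  apply: (cauchy_estimate r20 _ gl) => w w1 w2; apply: gM.
    rewrite (_ : w - z = (w - (z + t%:C * v)) + t%:C * v); last by ring.
    rewrite ReD (splitr r); apply: le_trans (ler_normD _ _) (lerD w1 _).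
    by rewrite ReT tv.
  rewrite (_ : w - z = (w - (z + t%:C * v)) + t%:C * v); last by ring.
  rewrite ImD (splitr r); apply: le_trans (ler_normD _ _) (lerD w2 _).
  by rewrite ImT tv.
(* the common properties of the real and imaginary parts *)
pose P (p : R[i] -> R) := [/\ forall x y, p (x - y) = p x - p y,
  forall (t : R) x, p (t%:C * x) = t * p x & forall x, `|p x| <= cmod x].
have main p : P p -> `|p (g (z + v) - g z)| <= 16 * M / r * cmod v.
  move=> [pB pZ pn].
  pose f (t : R) := p (g (z + t%:C * v)).
  have [dl dlP] : exists dl : R -> R, forall t : R, 0 <= t <= 1 ->
      is_derive t 1 f (dl t) /\ `|dl t| <= 16 * M / r * cmod v.
    suff /choice[dl dlP] : forall t : R, exists d : R, 0 <= t <= 1 ->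
      is_derive t 1 f d /\ `|d| <= 16 * M / r * cmod v by exists dl.
    move=> t; have [t01|nt] := boolP (0 <= t <= 1); last by exists 0.
    have [l gl lM] := dM t t01; exists (p (l * v)) => _; split.
      apply: is_derive_eps => e e0.
      have k0 : 0 < cmod v + 1 by rewrite ltr_wpDl ?cmod_ge0.
      have [d d0 dh] := gl (e / (cmod v + 1)) ltac:(by rewrite divr_gt0).
      exists (d / (cmod v + 1)); first by rewrite divr_gt0.
      move=> y; rewrite ltr_pdivlMr// => yt.
      have Ev : z + y%:C * v - (z + t%:C * v) = (y - t)%:C * v by rewrite rmorphB; ring.
      have := dh (z + y%:C * v); rewrite Ev cmodM cmod_real.
      have yv : `|y - t| * cmod v < d.
        by apply: le_lt_trans yt; rewrite ler_wpM2l// lerDl.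
      move=> /(_ yv) H.
      have -> : f y - f t - p (l * v) * (y - t)
          = p (g (z + y%:C * v) - g (z + t%:C * v) - l * ((y - t)%:C * v)).
        by rewrite !pB /f; congr (_ - _); rewrite mulrC -pZ; congr p; ring.
      apply: le_trans (pn _) _; apply: le_trans H _.
      have -> : e / (cmod v + 1) * (`|y - t| * cmod v)
          = e * `|y - t| * (cmod v / (cmod v + 1)) by field; rewrite gt_eqF.
      apply: ler_piMr; first by rewrite mulr_ge0// ltW.
      by rewrite ler_pdivrMr// mul1r lerDl ler01.
    by apply: le_trans (pn _) _; rewrite cmodM ler_wpM2r// cmod_ge0.
  have [t t01||c] := @MVT_segment R f dl 0 1 ler01.
  - by apply: (dlP t _).1; move: t01; rewrite in_itv /= => /andP[? ?]; rewrite !ltW.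
  - apply: derivable_within_continuous => t; rewrite in_itv /= => t01.
    by have [[]] := dlP t t01.
  rewrite in_itv /= => c01; rewrite subr0 mulr1 /f -pB mul1r mul0r addr0 => ->.
  by have [] := dlP c c01.
have hR := main (@complex.Re R) ltac:(by split; [exact: ReB|move=> t [? ?] /=; ring|exact: normRe_le]).
have hI := main (@complex.Im R) ltac:(by split; [exact: ImB|move=> t [? ?] /=; ring|exact: normIm_le]).
apply: le_trans (cmod_le_ReIm _) _; apply: le_trans (lerD hR hI) _.
by rewrite le_eqVlt; apply/orP; left; apply/eqP; field; rewrite gt_eqF.
Qed.

End ComplexDerivable.

(** * Lower bounds for Hausdorff measure *)

Section Covering.
Variable R : realType.
Notation mu := (@lebesgue_measure R).
Local Open Scope ereal_scope.

(** By induction on the number of coordinates: slice along one of them, apply the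
    bound to each slice, for which only the cubes that it meets count, and integrate
    over the position of the slice. *)
Lemma cover_volume (I : eqType) (ks : seq I) (s : R) (b : I -> R)
    (P : nat -> bool) (a : nat -> I -> R) (l : nat -> R) :
  uniq ks -> (0 <= s)%R -> (forall k, 0 <= l k)%R ->
  (forall y : I -> R, (forall i, i \in ks -> b i <= y i <= b i + s)%R ->
    exists k, P k /\ forall i, i \in ks -> (a k i <= y i <= a k i + l k)%R) ->
  (s ^+ size ks)%:E <= \sum_(0 <= k <oo) (if P k then l k ^+ size ks else 0%R)%:E.
Proof.
move=> + s0 l0; elim: ks P => [|i ks IH] P /=.
  move=> _ /(_ b)[//|k [Pk _]]; rewrite expr0.
  apply: (@le_trans _ _ (\sum_(0 <= j < k.+1) (if P j then 1%R else 0%R)%:E)).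
    rewrite big_nat_recr//= Pk leeDr// sume_ge0// => j _.
    by case: ifP; rewrite lee_fin.
  by apply: nneseries_lim_ge => j _ _; case: ifP; rewrite lee_fin.
move=> /andP[iks uks] cov.
(* the contribution of the k-th cube, spread over its extent in direction i *)
pose c k := (if P k then l k ^+ size ks else 0)%R.
pose J k := `[a k i, (a k i + l k)%R]%classic.
have c0 k : (0 <= c k)%R by rewrite /c; case: ifP => // _; exact: exprn_ge0.
have slice x : (b i <= x <= b i + s)%R ->
    (s ^+ size ks)%:E <= \sum_(0 <= k <oo) (c k)%:E * (\1_(J k) x)%:E.
  move=> xb.
  have := IH (fun k => P k && (a k i <= x <= a k i + l k)%R) uks.
  move=> /(_ _)/le_trans; apply.
    move=> y yb; have [|k [Pk yk]] := cov (fun j => if j == i then x else y j).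
      move=> j; rewrite inE; case: eqVneq => [-> _//|_ /=]; exact: yb.
    have := yk i; rewrite inE eqxx => /(_ isT) xk.
    exists k; rewrite Pk xk; split => // j jks.
    have ji : j != i by apply: contraNneq iks => <-.
    by have := yk j; rewrite inE jks orbT (negbTE ji) => /(_ isT).
  apply: lee_nneseries => k _.
    by case: ifP => _; rewrite lee_fin// exprn_ge0.
  rewrite -EFinM lee_fin /c indicE.
  have -> : (x \in J k) = (a k i <= x <= a k i + l k)%R.
    by apply/idP/idP; rewrite /J inE /= in_itv.
  by case: (P k) => //=; rewrite ?mul0r//; case: ifP; rewrite ?mulr1 ?mulr0.
have D0 : mu `[b i, (b i + s)%R]%classic = s%:E.
  move: s0; rewrite le_eqVlt => /predU1P[<-|s0].
    by rewrite addr0 set_itv1 lebesgue_measure_set1.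
  by rewrite lebesgue_measure_itv/= lte_fin ltrDl s0 -EFinD addrC addKr.
have mJ k : mu (J k) = (l k)%:E.
  rewrite /J; have := l0 k; rewrite le_eqVlt => /predU1P[<-|lk0].
    by rewrite addr0 set_itv1 lebesgue_measure_set1.
  by rewrite lebesgue_measure_itv/= lte_fin ltrDl lk0 -EFinD addrC addKr.
have -> : (s ^+ (size ks).+1)%:E = \int[mu]_(x in `[b i, (b i + s)%R]) (s ^+ size ks)%:E.
  by rewrite exprSr EFinM -D0 integral_cst.
have mf k : measurable_fun `[b i, (b i + s)%R] (fun x : R => (c k)%:E * (\1_(J k) x)%:E).
  apply: measurable_funeM; apply/measurable_EFinP.
  by apply: measurable_indic; exact: measurable_itv.
apply: (@le_trans _ _ (\int[mu]_(x in `[b i, (b i + s)%R])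
    (\sum_(0 <= k <oo) (c k)%:E * (\1_(J k) x)%:E))).
  apply: ge0_le_integral => //.
  - by move=> x _; rewrite lee_fin exprn_ge0.
  - apply: (@ge0_emeasurable_sum _ _ _ _
      (fun k x => (c k)%:E * (\1_(J k) x)%:E) xpredT) => // k x _ _.
    by rewrite -EFinM lee_fin mulr_ge0.
rewrite integral_nneseries//; last first.
  by move=> k x _; rewrite -EFinM lee_fin mulr_ge0.
apply: lee_nneseries => [k _ _|k _].
  by apply: integral_ge0 => x _; rewrite -EFinM lee_fin mulr_ge0.
rewrite ge0_integralZl_EFin//; last first.
  by apply/measurable_EFinP; apply: measurable_indic; exact: measurable_itv.
rewrite integral_indic//; last exact: measurable_itv.
apply: (@le_trans _ _ ((c k)%:E * mu (J k))).
  rewrite lee_wpmul2l ?lee_fin//; apply: le_measure; rewrite ?inE//.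
  - by apply: measurableI; exact: measurable_itv.
  - exact: measurable_itv.
by rewrite mJ -EFinM lee_fin /c; case: ifP => _; rewrite ?mul0r// -exprSr.
Qed.

End Covering.

Section HausdorffLower.
Variables (R : realType) (n : nat).
Implicit Types (A : set (Cn R n)) (z w : Cn R n) (i k : 'I_n * bool).
Local Open Scope ereal_scope.

Lemma ediam_ge0 A : 0 <= ediam A.
Proof. by apply: ereal_sup_ubound; left. Qed.

Lemma enorm_le_ediam A z w : A z -> A w -> (enorm (z - w))%:E <= ediam A.
Proof. by move=> Az Aw; apply: ereal_sup_ubound; right; exists z, w. Qed.

Definition other_crds k : seq ('I_n * bool) := [seq i <- enum predT | i != k].

Lemma size_other_crds k : size (other_crds k) = n.*2.-1.
Proof.
rewrite /other_crds size_filter; have := count_predC (pred1 k) (enum predT).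
rewrite (eq_count (a1 := predC (pred1 k)) (a2 := fun i => i != k))//.
rewrite count_uniq_mem ?enum_uniq// mem_enum inE /= -cardE card_prod card_ord.
by rewrite card_bool muln2 add1n => <-.
Qed.

Lemma mem_other_crds k i : (i \in other_crds k) = (i != k).
Proof. by rewrite mem_filter mem_enum andbT. Qed.

(** A set of diameter d projects into a cube of side 2d, so that a cover of A
    induces a cover by cubes of the cube over which A lies. *)
Lemma hausdorff_ge_cube A k (b : 'I_n * bool -> R) (s : R) : (0 <= s)%R ->
  (forall y : 'I_n * bool -> R, (forall i, i != k -> b i <= y i <= b i + s)%R ->
     exists2 z, A z & forall i, i != k -> crd z i = y i) ->
  ((s / 2) ^+ n.*2.-1)%:E <= hausdorff n.*2.-1 A.
Proof.
move=> s0 cov; apply: (@le_trans _ _ (hausdorff_pre n.*2.-1 1 A)); last first.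
  by apply: ereal_sup_ubound; exists 1%R => //=; exact: ltr01.
apply: le_ereal_inf_tmp => _ [U [AU dU ->]].
have dfin j : ediam (U j) \is a fin_num.
  by rewrite ge0_fin_numE ?ediam_ge0//; apply: le_lt_trans (dU j) _; rewrite ltry.
pose d j := fine (ediam (U j)).
have dE j : ediam (U j) = (d j)%:E by rewrite /d fineK.
have d0 j : (0 <= d j)%R by rewrite fine_ge0// ediam_ge0.
have [p pU] : exists p : nat -> Cn R n, forall j, U j !=set0 -> U j (p j).
  suff /choice[p pU] : forall j, exists p, U j !=set0 -> U j p by exists p.
  move=> j; have [[p Up]|e] := pselect (U j !=set0); first by exists p.
  by exists 0%R.
have H := @cover_volume R _ (other_crds k) s b (fun j => `[< U j !=set0 >])
  (fun j i => crd (p j) i - d j)%R (fun j => 2 * d j)%R.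
have {H} := H _ s0 _ _.
rewrite size_other_crds => H.
have {H} : (s ^+ n.*2.-1)%:E <= \sum_(0 <= j <oo)
    (2 ^+ n.*2.-1)%:E * (ediam (U j) ^+ n.*2.-1).
  apply: le_trans.
    apply: H.
    - by rewrite filter_uniq// enum_uniq.
    - by move=> j; rewrite mulr_ge0.
    - move=> y yb; have [i ik|z Az zy] := cov y.
        by apply: yb; rewrite mem_other_crds.
      have [j _ Ujz] := AU z Az; exists j; split; first by apply/asboolP; exists z.
      move=> i; rewrite mem_other_crds => ik; rewrite -(zy i ik).
      have Ujp := pU j (ex_intro _ _ Ujz).
      have : (`|crd z i - crd (p j) i| <= d j)%R.
        rewrite -crdB; apply: le_trans (normr_crd_le_enorm _ _) _.
        by rewrite -lee_fin -dE; exact: enorm_le_ediam.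
      by rewrite ler_norml; lra.
  apply: lee_nneseries => j _.
    by rewrite lee_fin; case: ifP => // _; rewrite exprn_ge0// mulr_ge0.
  rewrite dE -EFin_expe -EFinM lee_fin -exprMn.
  by case: ifP => // _; rewrite exprn_ge0// mulr_ge0.
rewrite nneseriesZl; last by move=> j _; rewrite dE -EFin_expe lee_fin exprn_ge0.
move=> H; rewrite expr_div_n EFinM muleC.
by rewrite lee_pdivrMl ?exprn_gt0.
Qed.

End HausdorffLower.

(** * The defining function at small scales *)

Section DefiningFunction.
Variables (R : realType) (n : nat) (D U : set (Cn R n)) (rho : Cn R n -> R).
Hypotheses (Dbd : ebounded D) (Dop : open D) (df : defining_function D U rho).
Implicit Types (z w : Cn R n) (i k : 'I_n * bool).

Definition pd i z : R := rpartial (dir R i.2) i.1 rho z.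

Lemma dir_cases (b : bool) : dir R b = 1 \/ dir R b = iC.
Proof. by case: b; [right|left]. Qed.

Lemma rho_continuous z : U z -> {for z, continuous rho}.
Proof. by case: (df_smooth df 0) => h _; exact: h. Qed.

Lemma pd_continuous i z : U z -> {for z, continuous (pd i)}.
Proof.
case: (df_smooth df 1) => _ /(_ i.1 _ (dir_cases i.2)) [_ [h _]]; exact: h.
Qed.

Definition move i z (t : R) : Cn R n := line (dir R i.2) i.1 z t.

Lemma moveD i z s t : move i (move i z s) t = move i z (t + s).
Proof. by apply: crd_inj => j; rewrite !crd_line; case: eqVneq => _; ring. Qed.

Lemma rho_move_derive i z t : U (move i z t) ->
  is_derive t 1 (fun s => rho (move i z s)) (pd i (move i z t)).
Proof.
move=> Uz; case: (df_smooth df 1) => _ /(_ i.1 _ (dir_cases i.2)) [/(_ _ Uz) dh _].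
have E : (fun h : R => rho (move i z (h *: 1 + t))) =
         (fun s : R => rho (line (dir R i.2) i.1 (move i z t) s)).
  by apply/funext => h; rewrite -[line _ _ (move _ _ _) _]/(move i _ _) moveD [_ *: 1]mulr1.
apply: DeriveDef; first by apply/derivable1P; rewrite E.
rewrite -derive1E /pd /rpartial /derive1.
set F := (fun _ : R => _); set G := (fun _ : R => _).
suff -> : F = G by [].
apply/funext => h; rewrite /F /G.
by rewrite -![line _ _ (move _ _ _) _]/(move i _ _) !moveD addr0 add0r.
Qed.

Lemma rho_move_mvt i z (a b : R) : a <= b ->
  (forall s, a <= s <= b -> U (move i z s)) ->
  exists2 s, a <= s <= b &
    rho (move i z b) - rho (move i z a) = pd i (move i z s) * (b - a).
Proof.
move=> ab Us.
have [s||s] := @MVT_segment R (fun s => rho (move i z s))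
  (fun s => pd i (move i z s)) a b ab.
- by rewrite in_itv /= => sab; apply: rho_move_derive; apply: Us; lra.
- apply: derivable_within_continuous => s; rewrite in_itv /= => sab.
  by have [] := rho_move_derive (Us s sab).
by rewrite in_itv /= => sab E; exists s.
Qed.

Lemma near_box_move e i z w t : near_box e z w ->
  `|crd w i + t - crd z i| < e -> near_box e z (move i w t).
Proof.
by move=> zw h j; rewrite crd_line; case: eqVneq => [->//|_]; rewrite addr0.
Qed.

(** Moving one coordinate after the other, a bound for the partial derivatives on
    a box is a Lipschitz bound. *)
Lemma rho_box_lipschitz e L z : 0 <= L ->
  (forall w, near_box e z w -> U w /\ forall i, `|pd i w| <= L) ->
  forall w w' t, near_box e z w -> near_box e z w' ->
    (forall i, `|crd w i - crd w' i| <= t) ->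
    `|rho w - rho w'| <= n.*2%:R * L * t.
Proof.
move=> L0 H w w' t zw zw' wt.
have main (ks : seq ('I_n * bool)) : forall w, near_box e z w ->
    (forall i, `|crd w i - crd w' i| <= t) ->
    (forall i, i \notin ks -> crd w i = crd w' i) ->
    `|rho w - rho w'| <= (size ks)%:R * (L * t).
  elim: ks => [|k ks IH] v zv vt vks.
    by rewrite mul0r (_ : v = w') ?subrr ?normr0//; apply: crd_inj => i; exact: vks.
  have t0 : 0 <= t by apply: le_trans (vt k).
  pose h := crd w' k - crd v k.
  have zvs s : (0 <= s <= h) || (h <= s <= 0) -> near_box e z (move k v s).
    move=> sh; apply: near_box_move => //.
    have := zv k; have := zw' k; rewrite !ltr_norml /h in sh *.
    by case/orP: sh; lra.
  have zvh : near_box e z (move k v h).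
    by apply: zvs; case: (leP 0 h) => h0; rewrite !lexx ?h0 ?(ltW h0) ?orbT.
  have step : `|rho v - rho (move k v h)| <= L * t.
    have ht : `|h| <= t by rewrite /h distrC.
    have v0 : move k v 0 = v by apply: crd_inj => j; rewrite crd_line; case: ifP; rewrite addr0.
    have [h0|h0] := leP 0 h.
      have [s sh E] := @rho_move_mvt k v 0 h h0 (fun s sh => (H _ (zvs s ltac:(by rewrite sh))).1).
      rewrite distrC -{2}v0 E subr0 normrM ler_pM//.
      by apply: (H _ _).2; apply: zvs; rewrite sh.
    have [s sh E] := @rho_move_mvt k v h 0 (ltW h0) (fun s sh => (H _ (zvs s ltac:(by rewrite sh orbT))).1).
    rewrite -{1}v0 E sub0r normrM normrN ler_pM//.
    by apply: (H _ _).2; apply: zvs; rewrite sh orbT.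
  have -> : rho v - rho w' = (rho v - rho (move k v h)) + (rho (move k v h) - rho w') by ring.
  apply: le_trans (ler_normD _ _) _.
  rewrite /= -natr1 mulrDl mul1r addrC; apply: lerD => //.
  apply: IH => // i.
    rewrite crd_line; case: eqVneq => [->|_]; last by rewrite addr0.
    by rewrite (_ : _ - _ = 0) ?normr0; [exact: le_trans (vt k)|rewrite /h; ring].
  move=> iks; rewrite crd_line; case: eqVneq => [->|ik]; first by rewrite /h; ring.
  by rewrite addr0; apply: vks; rewrite inE negb_or ik.
have := main (enum predT) w zw wt (fun i => _).
rewrite -cardE card_prod card_ord card_bool muln2 mulrA; apply => i.
by rewrite mem_enum.
Qed.

Lemma D_sub_U z : D z -> U z.
Proof. by move=> Dz; apply: (df_nbhs df); exact: subset_closure. Qed.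

Lemma rho_gt0 z : D z -> 0 < rho z.
Proof. by rewrite (df_eq df) => -[]. Qed.

Lemma D_of_rho z : U z -> 0 < rho z -> D z.
Proof. by move=> Uz rz; rewrite (df_eq df). Qed.

Lemma frontierP z : closure D z -> ~ D z -> frontier D z.
Proof. by move=> cz nz; split => // /interior_subset. Qed.

Lemma nbhs_box_lt z (u : Cn R n -> R) (e : R) : {for z, continuous u} -> 0 < e ->
  \forall w \near nbhs z, `|u w - u z| < e.
Proof.
by move=> /continuous_boxP h e0; apply/nbhs_boxP; exact: h.
Qed.

(** Using 1/e as the bound for the derivatives makes the property monotone in e, so
    that a single scale serves both for the domain and for the bound. *)
Lemma lipschitz_scale : exists2 e : R, 0 < e & forall z, closure D z ->
  forall w, near_box e z w -> U w /\ forall i, `|pd i w| <= e^-1.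
Proof.
apply: (compact_scale (compact_closure Dbd)).
  move=> e e' z e'0 e'e H w zw; have [|Uw h] := H w.
    exact: near_box_le zw.
  split => // i; apply: le_trans (h i) _.
  by rewrite lef_pV2 ?posrE// (lt_le_trans e'0).
move=> z cz; have Uz := df_nbhs df cz.
have : nbhs z (fun w => U w /\ forall i, `|pd i w - pd i z| < 1).
  have hU : nbhs z U by apply: open_nbhs_nbhs; split => //; exact: (df_open df).
  have hp : \forall w \near nbhs z, forall i, `|pd i w - pd i z| < 1.
    by apply: filter_forall => i; apply: nbhs_box_lt => //; exact: pd_continuous.
  exact: filterI hU hp.
move=> /nbhs_boxP[d d0 dh].
pose B := 1 + \sum_i `|pd i z|.
have B0 : 0 < B by rewrite ltr_pwDl// sumr_ge0.
exists (Num.min (d / 2) B^-1); first by rewrite lt_min divr_gt0// invr_gt0.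
set e := Num.min _ _.
have e0 : 0 < e by rewrite lt_min divr_gt0// invr_gt0.
have ed : e <= d / 2 by rewrite ge_min lexx.
have eB : e <= B^-1 by rewrite ge_min lexx orbT.
move=> w zw _ v wv; have [|Uv hv] := dh v.
  by apply: (@near_box_le _ _ (e + e)); [lra|exact: near_box_trans wv].
split => // i; apply: (@le_trans _ _ B); last by rewrite -(invrK B) lef_pV2 ?posrE ?invr_gt0.
rewrite -(subrK (pd i z) (pd i v)); apply: le_trans (ler_normD _ _) _.
apply: lerD; first by rewrite ltW// hv.
by rewrite (bigD1 i)//= lerDl sumr_ge0.
Qed.

Lemma gradient_neq0 z : frontier D z -> exists i, pd i z != 0.
Proof.
move=> fz; have [c c0 /(_ z fz) h] := df_grad df.
apply: contrapT => /forallNP no.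
have p0 i : pd i z = 0 by apply/eqP/negbNE/negP; exact: no.
move: h; rewrite /dnorm big1 ?sqrtr0 ?leNgt ?c0// => j _.
have := p0 (j, false); have := p0 (j, true); rewrite /pd /= => -> ->.
by rewrite expr0n addr0.
Qed.

(** Near a frontier point some partial derivative keeps its sign, given by the
    boolean s, and stays away from 0. Near an interior point the hypothesis
    rho z <= e fails for small e. *)
Lemma gradient_scale : exists2 e : R, 0 < e & forall z, closure D z -> rho z <= e ->
  exists i (s : bool), forall w, near_box e z w -> U w /\ e <= (-1) ^+ s * pd i w.
Proof.
apply: (compact_scale (compact_closure Dbd)).
  move=> e e' z e'0 e'e H rz; have [|i [s h]] := H; first exact: le_trans e'e.
  exists i, s => w zw; have [|Uw p] := h w; first exact: near_box_le zw.
  by split => //; exact: le_trans p.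
move=> z cz; have Uz := df_nbhs df cz.
have [Dz|nDz] := pselect (D z).
  have rz := rho_gt0 Dz.
  have /continuous_boxP/(_ (rho z / 2))[|d d0 dh] := rho_continuous Uz.
    by rewrite divr_gt0.
  exists (Num.min d (rho z / 4)); first by rewrite lt_min d0 divr_gt0.
  move=> w zw _ rw.
  have := dh w (near_box_le _ zw); rewrite ge_min lexx => /(_ isT).
  by move: rw; rewrite le_min ltr_norml => /andP[_ ?]; lra.
have [i pi0] := gradient_neq0 (frontierP cz nDz).
have : nbhs z (fun w => U w /\ `|pd i w - pd i z| < `|pd i z| / 2).
  have hU : nbhs z U by apply: open_nbhs_nbhs; split => //; exact: (df_open df).
  apply: filterI hU _.
  by apply: nbhs_box_lt; [exact: pd_continuous|rewrite divr_gt0// normr_gt0].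
move=> /nbhs_boxP[d d0 dh].
have p0 : 0 < `|pd i z| by rewrite normr_gt0.
exists (Num.min (d / 2) (`|pd i z| / 2)); first by rewrite lt_min !divr_gt0.
set e := Num.min _ _.
have ed : e <= d / 2 by rewrite ge_min lexx.
have ep : e <= `|pd i z| / 2 by rewrite ge_min lexx orbT.
move=> w zw _ _; exists i, (pd i z < 0) => v wv; have [|Uv hv] := dh v.
  by apply: (@near_box_le _ _ (e + e)); [lra|exact: near_box_trans wv].
split => //; move: hv ep p0; rewrite ltr_norml.
case: (ltrP (pd i z) 0) => pz; rewrite ?expr1 ?expr0.
  by rewrite (ltr0_norm pz); lra.
by rewrite (ger0_norm pz); lra.
Qed.

End DefiningFunction.

(** * Hausdorff measure of the level sets *)

Section LevelSets.
Variables (R : realType) (n : nat) (D U : set (Cn R n)) (rho : Cn R n -> R).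
Hypotheses (n_gt0 : (0 < n)%N) (Dbd : ebounded D) (Dop : open D) (df : defining_function D U rho).
Implicit Types (z w v : Cn R n) (i k : 'I_n * bool).

Definition of_crd (y : 'I_n * bool -> R) : Cn R n :=
  \row_j (y (j, false) +i* y (j, true)).

Lemma crd_of_crd y i : crd (of_crd y) i = y i.
Proof. by case: i => j []; rewrite /crd /of_crd mxE. Qed.

(** At scale e, rho is L-Lipschitz and, near the boundary, strictly monotone in
    some real coordinate direction. *)
Record regular_scale (e L : R) : Prop := RegularScale {
  rs_pos : 0 < e;
  rs_le1 : e <= 1;
  rs_leL : 1 <= L;
  rs_U : forall z w, closure D z -> near_box e z w -> U w;
  rs_lip : forall z w w' t, closure D z -> near_box e z w -> near_box e z w' ->
    (forall i, `|crd w i - crd w' i| <= t) -> `|rho w - rho w'| <= L * t;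
  rs_grad : forall z, closure D z -> rho z <= e -> exists k (s : bool),
    forall w t, 0 <= t -> near_box e z w -> near_box e z (move k w t) ->
      e * t <= (-1) ^+ s * (rho (move k w t) - rho w)
}.

Lemma regular_scale_exists : exists e L, regular_scale e L.
Proof.
have [e1 e10 h1] := lipschitz_scale Dbd df.
have [e2 e20 h2] := gradient_scale Dbd df.
pose e := Num.min 1 (Num.min e1 e2).
have e0 : 0 < e by rewrite !lt_min ltr01 e10.
have ee1 : e <= e1 by rewrite !ge_min lexx orbT.
have ee2 : e <= e2 by rewrite !ge_min lexx !orbT.
exists e, (1 + n.*2%:R * e1^-1); apply: RegularScale.
- exact: e0.
- by rewrite ge_min lexx.
- by rewrite lerDl mulr_ge0// invr_ge0 ltW.
- by move=> z w cz zw; apply: (h1 z cz w _).1; exact: near_box_le zw.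
- move=> z w w' t cz zw zw' ww'.
  apply: (@le_trans _ _ (n.*2%:R * e1^-1 * t)).
    apply: (rho_box_lipschitz df _ (h1 z cz)) => //.
    - by rewrite invr_ge0 ltW.
    - exact: near_box_le zw.
    - exact: near_box_le zw'.
  rewrite mulrDl mul1r lerDr.
  exact: le_trans (ww' (Ordinal n_gt0, false)).
- move=> z cz rz; have [|k [s h]] := h2 z cz; first exact: le_trans ee2.
  exists k, s => w t t0 zw zwt.
  have zs u : 0 <= u <= t -> near_box e2 z (move k w u).
    move=> ut; apply: near_box_le ee2 _; apply: near_box_move => //.
    have := zw k; have := zwt k; rewrite crd_line eqxx !ltr_norml; lra.
  have w0 : move k w 0 = w by apply: crd_inj => j; rewrite crd_line; case: ifP; rewrite addr0.
  have [u ut E] := @rho_move_mvt _ _ _ _ _ df k w 0 t t0 (fun u ut => (h _ (zs u ut)).1).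
  rewrite w0 subr0 in E; rewrite E mulrA ler_wpM2r//.
  by apply: le_trans ee2 _; exact: (h _ (zs u ut)).2.
Qed.

Lemma level_frontier_out r w : 0 < r -> frontier (level_domain D rho r) w ->
  D w /\ rho w = r.
Proof.
move=> r0 [cw niw].
have cDw : closure D w by apply: closureS cw => z [].
have Uw := df_nbhs df cDw; have cr := rho_continuous df Uw.
have rw : r <= rho w.
  rewrite leNgt; apply/negP => lt.
  have d0 : 0 < r - rho w by rewrite subr_gt0.
  have [v [[_ rv]]] := cw _ (nbhs_box_lt cr d0).
  by rewrite ltr_norml => /andP[_]; lra.
have Dw : D w by apply: (D_of_rho df) => //; exact: lt_le_trans rw.
split => //; apply/eqP; rewrite eq_le rw andbT leNgt; apply/negP => lt.
apply: niw; have d0 : 0 < rho w - r by rewrite subr_gt0.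
have nD : nbhs w D by apply: open_nbhs_nbhs.
apply: filterS (filterI nD (nbhs_box_lt cr d0)) => v [Dv].
by rewrite ltr_norml => /andP[h _]; split => //; lra.
Qed.

(** A point of {rho = r} that is a limit of points with rho > r belongs to the closure
    of the level domain, and it does not belong to the level domain itself. *)
Lemma level_frontier_in r w : U w -> rho w = r -> 0 < r ->
  (forall d, 0 < d -> exists v, [/\ near_box d w v, U v & r < rho v]) ->
  frontier (level_domain D rho r) w.
Proof.
move=> Uw rw r0 h; split; last by move=> /interior_subset[_]; rewrite rw ltxx.
move=> B /nbhs_boxP[d d0 dB]; have [v [wv Uv rv]] := h d d0.
exists v; split; last exact: dB.
by split => //; apply: (D_of_rho df) => //; exact: lt_trans rv.
Qed.

Variables (e L : R).
Hypothesis rs : regular_scale e L.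

Lemma move0 k w : move k w 0 = w.
Proof. by apply: crd_inj => j; rewrite crd_line; case: ifP; rewrite addr0. Qed.

(** The level set meets each line in the good direction close to z, so that the
    part of it near z projects onto a full cube. *)
Lemma level_hausdorff_lower z d r : D z -> rho z <= e -> 0 < d -> d <= e ->
  0 < r -> rho z - e * d / 4 <= r -> r <= rho z ->
  (((e * d / (4 * L)) ^+ n.*2.-1)%:E <= hausdorff n.*2.-1
     (frontier (level_domain D rho r) `&` [set w | near_box d z w]))%E.
Proof.
move=> Dz rz d0 de r0 r1 r2; have cz : closure D z by exact: subset_closure.
have e0 := rs_pos rs; have e1 := rs_le1 rs; have L1 := rs_leL rs.
have [k [s hk]] := rs_grad rs cz rz.
(* rho varies by at most L t = e d / 4 on the transversal cube of half-side t,
   and by at least e d / 2 along the good direction *)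
pose t := e * d / (4 * L).
have L0 : 0 < 4 * L by lra.
have t0 : 0 < t by rewrite divr_gt0// mulr_gt0.
have Lt : L * t = e * d / 4 by rewrite /t; field; lra.
have td : t <= d / 4.
  rewrite /t ler_pdivrMr//; apply: (@le_trans _ _ (1 * d)); first by rewrite ler_wpM2r// ltW.
  rewrite mul1r -subr_ge0.
  have -> : d / 4 * (4 * L) - d = d * (L - 1) by field.
  by apply: mulr_ge0; [exact: ltW|lra].
have -> : e * d / (4 * L) = (2 * t) / 2 by rewrite -/t; field.
apply: (@hausdorff_ge_cube _ _ _ k (fun i => crd z i - t)); first by rewrite mulr_ge0 ?ltW.
move=> y yb; pose w := of_crd (fun i => if i == k then crd z k else y i).
have wi i : i != k -> crd w i = y i by move=> ik; rewrite crd_of_crd (negbTE ik).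
have wk : crd w k = crd z k by rewrite crd_of_crd eqxx.
have wz i : `|crd w i - crd z i| <= t.
  have [->|ik] := eqVneq i k; first by rewrite wk subrr normr0 ltW.
  by rewrite wi// ler_norml; have := yb i ik; lra.
have zw d' : t < d' -> near_box d' z w by move=> td' i; apply: le_lt_trans (wz i) td'.
have zm d' u : t < d' -> `|u| < d' -> near_box d' z (move k w u).
  move=> td' ud'; apply: near_box_move; first exact: zw.
  by rewrite wk addrAC subrr add0r.
have tle : t < e by lra.
have rwz : `|rho w - rho z| <= e * d / 4.
  rewrite -Lt; apply: (rs_lip rs cz (zw e tle)) => //.
  exact: near_box_refl.
have zme u : `|u| <= d / 2 -> near_box e z (move k w u).
  by move=> ud; apply: zm => //; lra.
pose f u := rho (move k w u).
have fc (a b : R) : - (d / 2) <= a -> b <= d / 2 -> {within `[a, b], continuous f}.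
  move=> ha hb; apply: derivable_within_continuous => u; rewrite in_itv /= => ub.
  have [] := @rho_move_derive _ _ _ _ _ df k w u (rs_U rs cz (zme u _)) => //.
  by rewrite ler_norml; lra.
have d20 : 0 <= d / 2 by lra.
have nd : `|d / 2| <= d / 2 by rewrite ger0_norm.
have nNd : `|- (d / 2)| <= d / 2 by rewrite normrN.
have nz : `|0 : R| <= d / 2 by rewrite normr0.
have up : e * (d / 2) <= (-1) ^+ s * (f (d / 2) - rho w).
  apply: hk => //; first exact: zw.
  exact: zme.
have dn : e * (d / 2) <= (-1) ^+ s * (rho w - f (- (d / 2))).
  have := hk (move k w (- (d / 2))) (d / 2) d20; rewrite moveD subrr move0.
  by apply; [exact: zme|exact: zw].
have [u ud fu] : exists2 u, `|u| <= d / 2 & f u = r.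
  have [|u] := @IVT R f (- (d / 2)) (d / 2) r ltac:(lra) (fc _ _ (lexx _) (lexx _)).
    rewrite ge_min le_max; move: up dn rwz; rewrite ler_norml.
    by case: (s); rewrite ?expr1 ?expr0; [move=> ? ? ?; apply/andP; split; apply/orP; [right|left]; lra|
      move=> ? ? ?; apply/andP; split; apply/orP; [left|right]; lra].
  by rewrite in_itv /= -ler_norml => ud fu; exists u.
exists (move k w u); last first.
  by move=> i ik; rewrite crd_line (negbTE ik) addr0 wi.
split; last by apply: zm; lra.
apply: level_frontier_in => //; first exact: (rs_U rs cz (zme u ud)).
move=> d' d'0.
(* a short step along the good direction increases rho *)
pose h := Num.min (d' / 2) (d / 4).
have h0 : 0 < h by rewrite lt_min !divr_gt0.
have hd' : h <= d' / 2 by rewrite ge_min lexx.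
have hd : h <= d / 4 by rewrite ge_min lexx orbT.
pose sg : R := (-1) ^+ s.
have nsg : `|sg| = 1 by rewrite /sg normrX normrN normr1 expr1n.
have zb : near_box e z (move k w (u + sg * h)).
  apply: zm => //; apply: le_lt_trans (ler_normD _ _) _.
  by rewrite normrM nsg mul1r (gtr0_norm h0); lra.
exists (move k w (u + sg * h)); split.
- rewrite addrC -moveD; apply: near_box_move; first exact: near_box_refl.
  by rewrite addrAC subrr add0r normrM nsg mul1r gtr0_norm//; lra.
- exact: (rs_U rs cz zb).
- rewrite -[X in X < _]fu -subr_gt0.
  have eh : 0 < e * h by rewrite mulr_gt0.
  move: zb; rewrite /f /sg; case: (s) hk => hk; rewrite ?expr1 ?expr0 ?mulN1r ?mul1r => zb.
    have := hk (move k w (u - h)) h (ltW h0) zb; rewrite moveD addrC subrK.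
    by move=> /(_ (zme u ud)); rewrite expr1 mulN1r; lra.
  have := hk (move k w u) h (ltW h0) (zme u ud); rewrite moveD addrC.
  by move=> /(_ zb); rewrite expr0 mul1r; lra.
Qed.

End LevelSets.

Section HausdorffUpper.
Variables (R : realType) (n : nat).
Implicit Types (A : set (Cn R n)).

Lemma ediam_le A (x : R) : 0 <= x ->
  (forall z w, A z -> A w -> enorm (z - w) <= x) -> (ediam A <= x%:E)%E.
Proof.
move=> x0 h; apply: ge_ereal_sup => _ [->|[z [w [Az Aw ->]]]].
  by rewrite lee_fin.
by rewrite lee_fin; exact: h.
Qed.

(** A finite cover is padded with empty sets, which have diameter 0 and contribute
    nothing because s > 0. *)
Lemma hausdorff_pre_finite (T : finType) (V : T -> set (Cn R n)) A
    (x d : R) (s : nat) : (0 < s)%N -> 0 <= x -> x <= d ->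
  (forall z, A z -> exists t, V t z) -> (forall t, (ediam (V t) <= x%:E)%E) ->
  (hausdorff_pre s d A <= (#|T|%:R * x ^+ s)%:E)%E.
Proof.
move=> s0 x0 xd AV Vx.
have e0s : (0 ^+ s = 0 :> \bar R)%E by case: (s) s0 => // k _; rewrite expeS mul0e.
pose W k := if insub k is Some j then V (@enum_val T predT j) else set0.
have W0 k : (#|T| <= k)%N -> W k = set0.
  by move=> Tk; rewrite /W insubF// ltnNge Tk.
have Wx k : (ediam (W k) <= x%:E)%E.
  rewrite /W; case: insubP => [j _ _|_]; first exact: Vx.
  exact: ediam_le.
have xs0 : 0 <= x ^+ s by rewrite exprn_ge0.
have Wxs k : (ediam (W k) ^+ s <= (x ^+ s)%:E)%E.
  have wf : ediam (W k) \is a fin_num.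
    by rewrite ge0_fin_numE ?ediam_ge0//; apply: le_lt_trans (Wx k) _; rewrite ltry.
  rewrite -(fineK wf) -EFin_expe lee_fin lerXn2r ?nnegrE//.
    by rewrite fine_ge0// ediam_ge0.
  by rewrite -lee_fin fineK.
have Ws0 k : (0 <= ediam (W k) ^+ s)%E by rewrite expe_ge0// ediam_ge0.
apply: (@le_trans _ _ (\sum_(0 <= k <oo) ediam (W k) ^+ s)%E).
  apply: ereal_inf_lbound; exists W; split => //.
    move=> z /AV[t Vz]; exists (enum_rank t : nat) => //.
    rewrite /W; case: insubP => [j _ jt|]; last by rewrite ltn_ord.
    by have -> : j = enum_rank t; [exact: val_inj|rewrite enum_rankK].
  by move=> k; apply: le_trans (Wx k) _; rewrite lee_fin.
apply: lime_le; first by apply: is_cvg_nneseries.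
apply: nearW => N.
apply: (@le_trans _ _ ((minn N #|T|)%:R * x ^+ s)%:E); last first.
  by rewrite lee_fin ler_wpM2r// ler_nat geq_minr.
elim: N => [|N IH]; first by rewrite big_nil min0n mul0r.
rewrite big_nat_recr//=; have [NT|TN] := ltnP N #|T|.
  apply: le_trans (leeD IH (Wxs N)) _.
  by rewrite -EFinD lee_fin (minn_idPl NT) (minn_idPl (ltnW NT)) -natr1 mulrDl mul1r.
rewrite W0//; apply: le_trans (leeD IH (lexx _)) _.
have -> : ediam (set0 : set (Cn R n)) = 0%E.
  by apply/eqP; rewrite eq_le ediam_ge0 andbT; apply: ediam_le.
by rewrite e0s adde0 (minn_idPr TN) (minn_idPr (leqW TN)).
Qed.

Lemma cell_exists (N : nat) (h x : R) : (0 < N)%N -> 0 <= x <= N%:R * h ->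
  exists g : 'I_N, g%:R * h <= x <= (g%:R + 1) * h.
Proof.
case: N => // N _; elim: N => [|N IH] /andP[x0 xN].
  by exists ord0; rewrite mul0r add0r x0.
have [xle|xgt] := leP x (N.+1%:R * h).
  have [|g hg] := IH; first by rewrite x0.
  by exists (widen_ord (leqnSn _) g).
by exists ord_max => /=; rewrite natr1 xN ltW.
Qed.

End HausdorffUpper.

Section LevelUpper.
Variables (R : realType) (n : nat) (D U : set (Cn R n)) (rho : Cn R n -> R).
Hypotheses (n_gt0 : (0 < n)%N) (Dbd : ebounded D) (Dop : open D)
  (df : defining_function D U rho).
Variables (e L : R).
Hypothesis rs : regular_scale D U rho e L.
Implicit Types (z w v : Cn R n) (i k : 'I_n * bool).

Definition good_dir k z := exists s : bool, forall w t, 0 <= t ->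
  near_box e z w -> near_box e z (move k w t) ->
  e * t <= (-1) ^+ s * (rho (move k w t) - rho w).

(** Moving w in direction k until it has the same k-th coordinate as z changes rho by
    at least e times the displacement, and by at most L t since rho w = rho z. *)
Lemma level_graph k z w t : closure D z -> good_dir k z -> near_box e z w ->
  rho w = rho z -> (forall i, i != k -> `|crd w i - crd z i| <= t) -> 0 <= t ->
  forall i, `|crd w i - crd z i| <= L / e * t.
Proof.
move=> cz [s hk] zw rwz wt t0 i.
have e0 := rs_pos rs; have e1 := rs_le1 rs; have L1 := rs_leL rs.
have Le : 1 <= L / e by rewrite ler_pdivlMr// mul1r; lra.
have [ik|ik] := eqVneq i k; last first.
  by apply: le_trans (wt i ik) _; rewrite ler_peMl.
subst i.
rewrite mulrAC ler_pdivlMr// mulrC.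
pose h := crd z k - crd w k.
have hz : crd w k + h = crd z k by rewrite /h; ring.
have zwh : near_box e z (move k w h).
  by apply: near_box_move => //; rewrite hz subrr normr0.
have diff : `|rho (move k w h) - rho w| <= L * t.
  rewrite rwz; apply: (rs_lip rs cz zwh (near_box_refl _ e0)) => j.
  rewrite crd_line; case: eqVneq => [->|jk]; last by rewrite addr0 wt.
  by rewrite hz subrr normr0.
apply: le_trans diff.
have sg x : `|(-1) ^+ s * x| = `|x| :> R by rewrite normrM normrX normrN normr1 expr1n mul1r.
have [h0|h0] := leP 0 h.
  rewrite distrC -/h (ger0_norm h0); apply: le_trans (hk _ _ h0 zw zwh) _.
  by rewrite -(sg (_ - _)) ler_norm.
rewrite distrC -/h (ltr0_norm h0).
have hN : 0 <= - h by rewrite oppr_ge0 ltW.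
have := hk (move k w h) (- h) hN zwh; rewrite moveD addNr move0.
move=> /(_ zw) H; apply: le_trans H _.
by rewrite distrC -(sg (_ - _)) ler_norm.
Qed.

(** D lies in a grid of N^{2n} coarse cells smaller than the regular scale. In a
    coarse cell and for a given good direction the level set is a graph, so that
    dividing each of the other 2n-1 coordinates into m parts cuts it into m^{2n-1}
    pieces of diameter at most B/m. The sum of the powers of the diameters does not
    depend on m. *)
Lemma level_hausdorff_upper : exists2 C0 : R, 0 <= C0 & forall r, 0 < r -> r <= e ->
  (hausdorff n.*2.-1 (frontier (level_domain D rho r)) <= C0%:E)%E.
Proof.
have e0 := rs_pos rs; have e1 := rs_le1 rs; have L1 := rs_leL rs.
have [M' DM'] := Dbd; pose M := `|M'| + 1.
have M0 : 0 < M by rewrite ltr_wpDl.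
have DM z i : D z -> - M <= crd z i <= M.
  move=> Dz; rewrite -ler_norml; apply: le_trans (normr_crd_le_enorm _ _) _.
  apply: le_trans (DM' z Dz) _; apply: le_trans (ler_norm _) _.
  by rewrite lerDl.
pose N := (Num.bound (2 * M / e)).+1.
pose h := 2 * M / N%:R.
have h0 : 0 < h by rewrite divr_gt0 ?mulr_gt0.
have Nh : N%:R * h = 2 * M by rewrite /h mulrC divfK// pnatr_eq0.
have he : h < e.
  rewrite /h ltr_pdivrMr ?ltr0n// [ltRHS]mulrC -ltr_pdivrMr//.
  apply: (@lt_trans _ _ (Num.bound (2 * M / e))%:R); last by rewrite ltr_nat.
  by apply: archi_boundP; rewrite divr_ge0 ?mulr_ge0// ltW.
pose c := L / e.
have c0 : 0 < c by apply: divr_gt0 => //; lra.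
pose B := 2 * n%:R * (c * h).
have B0 : 0 <= B.
  by apply: mulr_ge0; apply: mulr_ge0 => //; [exact: ltW c0|exact: ltW h0].
pose C0 := (N ^ #|{: 'I_n * bool}| * #|{: 'I_n * bool}|)%:R * B ^+ n.*2.-1.
exists C0; first by rewrite mulr_ge0// exprn_ge0.
move=> r r0 re; apply: ge_ereal_sup => _ [d /= d0 <-].
have [m m0 md] : exists2 m : nat, (0 < m)%N & B / m%:R <= d.
  exists (Num.bound (B / d)).+1 => //.
  rewrite ler_pdivrMr ?ltr0n// [leRHS]mulrC -ler_pdivrMr//; apply: ltW.
  apply: (@lt_trans _ _ (Num.bound (B / d))%:R); last by rewrite ltr_nat.
  by apply: archi_boundP; rewrite divr_ge0// ltW.
have m0' : 0 < m%:R :> R by rewrite ltr0n.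
pose T := ({ffun 'I_n * bool -> 'I_N} * ('I_n * bool) * {ffun 'I_(n.*2.-1) -> 'I_m})%type.
have i0 : 'I_n * bool by exact: (Ordinal n_gt0, false).
pose corner (g : {ffun 'I_n * bool -> 'I_N}) i := - M + (g i)%:R * h.
pose V (t : T) : set (Cn R n) := [set w | [/\ D w /\ rho w = r,
  good_dir t.1.2 w,
  forall i, corner t.1.1 i <= crd w i <= corner t.1.1 i + h &
  forall j : 'I_(n.*2.-1), let i := nth i0 (other_crds t.1.2) j in
    corner t.1.1 i + (t.2 j)%:R * (h / m%:R) <= crd w i
      <= corner t.1.1 i + ((t.2 j)%:R + 1) * (h / m%:R)]].
have hm : m%:R * (h / m%:R) = h by rewrite mulrC divfK// gt_eqF.
have -> : C0 = #|{: T}|%:R * (B / m%:R) ^+ n.*2.-1.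
  have -> : #|{: T}| = (N ^ #|{: 'I_n * bool}| * #|{: 'I_n * bool}| * m ^ n.*2.-1)%N.
    rewrite card_prod [#|{: {ffun _ -> 'I_N} * _}|]card_prod.
    by rewrite [#|{ffun _ -> 'I_N}|]card_ffun [#|{ffun _ -> 'I_m}|]card_ffun !card_ord.
  rewrite /C0 [in RHS]natrM natrX expr_div_n -mulrA; congr (_ * _).
  by rewrite mulrC divfK// gt_eqF// exprn_gt0.
apply: (@hausdorff_pre_finite _ _ T V).
- by rewrite -subn1 subn_gt0 -addnn; case: (n) n_gt0 => // k _; rewrite addSnnS ltn_addl.
- by rewrite divr_ge0.
- exact: md.
- move=> z fz; have [Dz rz] := level_frontier_out Dop df r0 fz.
  have cz : closure D z by exact: subset_closure.
  have [k gk] := rs_grad rs cz ltac:(by rewrite rz).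
  have [g gP] : exists g : {ffun 'I_n * bool -> 'I_N},
      forall i, corner g i <= crd z i <= corner g i + h.
    suff /choice[g gP] : forall i, exists a : 'I_N,
      - M + a%:R * h <= crd z i <= - M + a%:R * h + h.
      by exists (finfun g) => i; rewrite /corner ffunE.
    move=> i; have [|a ha] := @cell_exists R N h (crd z i + M) isT.
      by rewrite Nh; have := DM z i Dz; lra.
    by exists a; move: ha; rewrite mulrDl mul1r; lra.
  have [f fP] : exists f : {ffun 'I_(n.*2.-1) -> 'I_m}, forall j : 'I_(n.*2.-1),
      let i := nth i0 (other_crds k) j in
      corner g i + (f j)%:R * (h / m%:R) <= crd z i
      <= corner g i + ((f j)%:R + 1) * (h / m%:R).
    suff /choice[f fP] : forall j : 'I_(n.*2.-1), exists a : 'I_m,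
      let i := nth i0 (other_crds k) j in
      corner g i + a%:R * (h / m%:R) <= crd z i
      <= corner g i + (a%:R + 1) * (h / m%:R).
      by exists (finfun f) => j; rewrite ffunE; exact: fP.
    move=> j /=; set i := nth _ _ _.
    have [|a ha] := @cell_exists R m (h / m%:R) (crd z i - corner g i) m0.
      by rewrite hm; have := gP i; lra.
    by exists a; move: ha; lra.
  by exists (g, k, f).
- move=> [[g k] f]; apply: ediam_le; first by rewrite divr_ge0.
  move=> z w [/= [Dz rz] gz zg zf] [/= [Dw rw] gw wg wf].
  have cz : closure D z by exact: subset_closure.
  have zw : near_box e z w.
    move=> i; rewrite ltr_norml; have := zg i; have := wg i; lra.
  have -> : B / m%:R = 2 * n%:R * (c * (h / m%:R)) by rewrite /B !mulrA.
  have hm0 : 0 <= h / m%:R by apply: divr_ge0 => //; exact: ltW h0.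
  apply: enorm_le_crd; first by apply: mulr_ge0 => //; exact: ltW c0.
  move=> i; rewrite crdB distrC; apply: (level_graph cz gz zw); rewrite ?rz//.
    move=> {}i ik.
    have iks : (index i (other_crds k) < n.*2.-1)%N.
      by rewrite -(size_other_crds k) index_mem mem_other_crds.
    have := zf (Ordinal iks); have := wf (Ordinal iks) => /=.
    rewrite nth_index ?mem_other_crds// ler_norml.
    rewrite [(_ + 1) * _]mulrDl mul1r; lra.
Qed.

End LevelUpper.

(** * Integrals against set functions *)

Section SetFunctionIntegral.
Context d (T : measurableType d) (R : realType).
Implicit Types (mu : set T -> \bar R) (f g : T -> \bar R) (A B D : set T).
Import HBNNSimple.
Local Open Scope ereal_scope.

Definition below f := [set h : {nnsfun T >-> R} | forall x, (h x)%:E <= f x].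

Lemma sintegral_below0 mu : mu set0 = 0 ->
  ereal_sup [set sintegral mu h | h in below (cst 0)] = 0.
Proof.
move=> mu0.
have s0 (h : {nnsfun T >-> R}) : below (cst 0) h -> sintegral mu h = 0.
  move=> h0; rewrite sintegralET fsbig1// => x _.
  have [->|x0] := eqVneq x 0%R; first by rewrite mul0e.
  rewrite (_ : h @^-1` [set x] = set0) ?mu0 ?mule0//.
  apply/seteqP; split => // t /= htx.
  have := h0 t; rewrite lee_fin /= htx => x0'.
  by move: x0; rewrite eq_le x0' -htx fun_ge0.
apply/eqP; rewrite eq_le; apply/andP; split.
  by apply: ge_ereal_sup => _ [h /s0 -> <-].
by apply: ereal_sup_ubound; exists nnsfun0 => //; apply: s0 => x /=.
Qed.

(** The integral is the difference of the suprema for the positive and the negative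
    part; the second one is 0 since a simple function below 0 takes nonzero values on
    empty sets only. *)
Lemma integral_supE mu D f : mu set0 = 0 -> (forall x, D x -> 0 <= f x) ->
  \int[mu]_(x in D) f x = ereal_sup [set sintegral mu h | h in below (f \_ D)].
Proof.
move=> mu0 f0; rewrite /integral funeneg_restrict funepos_restrict.
have /eq_restrictP-> := ge0_funeposE f0.
have /eq_restrictP-> := ge0_funenegE f0.
rewrite erestrict0.
transitivity (ereal_sup [set sintegral mu h | h in below (f \_ D)] -
    ereal_sup [set sintegral mu h | h in below (cst 0)]); first by [].
by rewrite (sintegral_below0 mu0) sube0.
Qed.

Lemma integral_ge_cst mu D A f (c : R) : mu set0 = 0 -> (0 <= c)%R ->
  measurable A -> A `<=` D -> (forall x, D x -> 0 <= f x) ->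
  (forall x, A x -> c%:E <= f x) ->
  c%:E * mu A <= \int[mu]_(x in D) f x.
Proof.
move=> mu0 c0 mA AD f0 cf; rewrite integral_supE//.
pose h : {nnsfun T >-> R} := scale_nnsfun (indic_nnsfun R mA) c0.
have hE x : h x = (c * \1_A x)%R by [].
apply: ereal_sup_ubound; exists h.
  move=> x; rewrite hE indicE patchE.
  have [xA|xA] := boolP (x \in A).
    have Ax := set_mem xA; rewrite mulr1 (mem_set (AD _ Ax)).
    exact: cf.
  by rewrite mulr0; case: ifPn => // /set_mem; exact: f0.
have [cz|cn0] := eqVneq c 0%R.
  rewrite cz mul0e sintegralET fsbig1// => x _.
  have [->|x0] := eqVneq x 0%R; first by rewrite mul0e.
  rewrite (_ : _ @^-1` _ = set0) ?mu0 ?mule0//.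
  apply/seteqP; split => // t tx; have {}tx : (c * \1_A t)%R = x := tx.
  rewrite cz mul0r in tx.
  by rewrite -tx eqxx in x0.
rewrite sintegralET -(@fsbig_widen _ _ _ _ [set c])//; last first.
  move=> x [_ /= xc]; have [->|x0] := eqVneq x 0%R; first by rewrite mul0e.
  rewrite (_ : _ @^-1` _ = set0) ?mu0 ?mule0//.
  apply/seteqP; split => // t tx; have {}tx : (c * \1_A t)%R = x := tx.
  rewrite indicE in tx.
  case: (t \in A) tx; rewrite ?mulr1 ?mulr0 => tx; first by rewrite tx in xc.
  by rewrite -tx eqxx in x0.
rewrite fsbig_set1; congr (_ * mu _); apply/seteqP; split => t; rewrite -[(h @^-1` _) t]/((c * \1_A t)%R = c) indicE.
  move=> /eqP; case: (boolP (t \in A)) => [/set_mem//|_].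
  by rewrite mulr0 eq_sym (negbTE cn0).
by move=> At; rewrite mem_set// mulr1.
Qed.

(** A simple function below f is at most c on each of its level sets, and these are
    disjoint subsets of D, so superadditivity is what bounds the sum of their
    masses. *)
Lemma integral_le_cst mu D f (c : R) : mu set0 = 0 -> (forall A, 0 <= mu A) ->
  (forall A B, A `&` B = set0 -> mu A + mu B <= mu (A `|` B)) ->
  (0 <= c)%R -> (forall x, D x -> 0 <= f x) -> (forall x, D x -> f x <= c%:E) ->
  \int[mu]_(x in D) f x <= c%:E * mu D.
Proof.
move=> mu0 mu_ge0 muD c0 f0 fc; rewrite integral_supE//.
have mu_mono A B : A `<=` B -> mu A <= mu B.
  move=> AB; have := muD A (B `\` A); rewrite setDIK setDUK// => /(_ erefl).
  by apply: le_trans; rewrite leeDl.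
apply: ge_ereal_sup => _ [h hf <-].
have hD x : h x != 0%R -> D x /\ (h x <= c)%R.
  move=> hx; have := hf x; rewrite patchE; case: ifPn => [/set_mem Dx|_] hfx.
    by split => //; rewrite -lee_fin; apply: le_trans hfx (fc x Dx).
  exfalso; move: hx; rewrite eq_le; move: hfx; rewrite lee_fin => ->.
  by rewrite fun_ge0.
have fr : finite_set (range h) by exact: fimfunP.
rewrite sintegralET -(@fsbig_widen _ _ _ _ (range h))//; last first.
  move=> x [_ /= xr]; rewrite (_ : h @^-1` [set x] = set0) ?mu0 ?mule0//.
  by apply/seteqP; split => // t /= tx; apply: xr; exists t.
rewrite fsbig_finite//=.
set s := fset_set (range h).
have step (r : seq R) : \sum_(x <- r) x%:E * mu (h @^-1` [set x]) <=
    \sum_(x <- r) c%:E * mu (D `&` h @^-1` [set x]).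
  apply: lee_sum => x _; have [->|x0] := eqVneq x 0%R.
    by rewrite mul0e mule_ge0.
  have [[t /= tx]|no] := pselect (h @^-1` [set x] !=set0); last first.
    rewrite (_ : h @^-1` [set x] = set0) ?setI0 ?mu0 ?mule0//.
    by apply/seteqP; split => // t tx; apply: no; exists t.
  have xc : (x <= c)%R by have [] := hD t; rewrite tx.
  have -> : D `&` h @^-1` [set x] = h @^-1` [set x].
    by apply/setIidr => u /= ux; have [] := hD u; rewrite ux.
  by rewrite lee_wpmul2r// lee_fin.
apply: (le_trans (step (finmap.enum_fset s))).
rewrite -ge0_sume_distrr//.
rewrite lee_wpmul2l ?lee_fin//.
suff main (r : seq R) : uniq r ->
    \sum_(x <- r) mu (D `&` h @^-1` [set x]) <= mu (D `&` [set t | h t \in r]).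
  apply: le_trans (main _ (finmap.fset_uniq _)) _; apply: mu_mono; exact: subIsetl.
elim: r => [|x r IH] /=; first by rewrite big_nil.
move=> /andP[xr ur]; rewrite big_cons.
apply: le_trans (leeD (lexx _) (IH ur)) _.
apply: le_trans (muD _ _ _) _.
  by apply/seteqP; split => // t [[_ /= tx] [_ /=]]; rewrite tx (negbTE xr).
apply: mu_mono => t [[Dt /= tx]|[Dt /= tr]]; split => //=.
  by rewrite tx mem_head.
by rewrite inE tr orbT.
Qed.

End SetFunctionIntegral.

Section LebesgueC.
Variable R : realType.
Import HBNNSimple.
Local Open Scope ereal_scope.

Lemma ereal_sup_add_le (A B : set (\bar R)) (x : \bar R) :
  A 0 -> B 0 -> (forall a, A a -> 0 <= a) -> (forall b, B b -> 0 <= b) ->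
  (forall a b, A a -> B b -> a + b <= x) -> ereal_sup A + ereal_sup B <= x.
Proof.
move=> A0 B0 Age Bge h.
have x0 : 0 <= x by have := h 0 0 A0 B0; rewrite adde0.
have [->|xoo] := eqVneq x +oo; first by rewrite leey.
have xf : x \is a fin_num by rewrite ge0_fin_numE// lt_neqAle xoo leey.
have xlt : x < +oo by rewrite -ge0_fin_numE.
have ax a : A a -> a <= x by move=> Aa; have := h a 0 Aa B0; rewrite adde0.
have supB a : A a -> ereal_sup B <= x - a.
  move=> Aa; have af : a \is a fin_num.
    by rewrite ge0_fin_numE ?Age//; exact: le_lt_trans (ax a Aa) xlt.
  apply: ge_ereal_sup => b Bb; rewrite leeBrDl// addeC.
  by rewrite addeC; exact: h.
have Bf : ereal_sup B \is a fin_num.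
  rewrite ge0_fin_numE; last by apply: ereal_sup_ubound.
  by apply: le_lt_trans (supB 0 A0) _; rewrite sube0 -ge0_fin_numE.
rewrite -leeBrDr//; apply: ge_ereal_sup => a Aa.
rewrite leeBrDr//.
have af : a \is a fin_num.
  by rewrite ge0_fin_numE ?Age//; exact: le_lt_trans (ax a Aa) xlt.
by have := supB a Aa; rewrite leeBrDl.
Qed.

(** For arbitrary integrands the integral is only a supremum over simple functions
    below; sums of such functions are simple functions below the sum. *)
Lemma integral_superadd d (T : measurableType d) (mu : {measure set T -> \bar R})
    (f g k : T -> \bar R) :
  (forall x, 0 <= f x) -> (forall x, 0 <= g x) -> (forall x, f x + g x <= k x) ->
  \int[mu]_x f x + \int[mu]_x g x <= \int[mu]_x k x.
Proof.
move=> f0 g0 fgk.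
have k0 x : 0 <= k x by apply: le_trans (fgk x); rewrite adde_ge0.
rewrite !integral_supE//.
have below0 (u : T -> \bar R) : (forall x, 0 <= u x) ->
    [set sintegral mu h | h in below (u \_ setT)] 0.
  by move=> u0; exists nnsfun0; [move=> x /=; rewrite patch_setT|exact: sintegral0].
apply: ereal_sup_add_le; [exact: below0|exact: below0|..].
- by move=> _ [h _ <-]; exact: sintegral_ge0.
- by move=> _ [h _ <-]; exact: sintegral_ge0.
move=> _ _ [h1 h1f <-] [h2 h2g <-]; rewrite -sintegralD//.
apply: ereal_sup_ubound; exists (add_nnsfun h1 h2) => // x.
rewrite patch_setT; apply: le_trans (fgk x).
have := h1f x; have := h2g x; rewrite !patch_setT => a b.
by rewrite EFinD leeD.
Qed.

Lemma lebesgueC_ge0 n A : 0 <= @lebesgueC R n A.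
Proof.
elim: n A => [|n IH] A /=; first by rewrite /dirac lee_fin.
by apply: integral_ge0 => x _; exact: IH.
Qed.

Lemma lebesgueC0 n : @lebesgueC R n set0 = 0.
Proof.
elim: n => [|n IH] /=; first by rewrite /dirac indicE in_set0.
by apply: integral0_eq => x _; exact: IH.
Qed.

(** By induction along the iterated definition: slices of disjoint sets are
    disjoint. *)
Lemma lebesgueC_superadd n (A B : set (Cn R n)) : A `&` B = set0 ->
  lebesgueC A + lebesgueC B <= lebesgueC (A `|` B).
Proof.
elim: n A B => [|n IH] A B AB.
  rewrite /= /dirac !indicE in_setU.
  case: (boolP (_ \in A)) => hA; case: (boolP (_ \in B)) => hB //=; rewrite ?adde0 ?add0e//.
  have : (A `&` B) 0%R by split; [exact: (set_mem hA)|exact: (set_mem hB)].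
  by rewrite AB.
apply: integral_superadd => x; [exact: lebesgueC_ge0|exact: lebesgueC_ge0|].
apply: le_trans (IH _ _ _) _ => //.
by apply/seteqP; split => // v [/= hA hB]; have := conj hA hB : (A `&` B) _; rewrite AB.
Qed.

Section Normalized.
Variables (n : nat) (mu : set (Cn R n) -> \bar R) (B : set (Cn R n)).
Hypotheses (mu_ge0 : forall A, 0 <= mu A) (mu0 : mu set0 = 0).

Lemma normalized_ge0 A : 0 <= normalized mu B A.
Proof. by rewrite /normalized mule_ge0// lee_fin invr_ge0 fine_ge0. Qed.

Lemma normalized0 : normalized mu B set0 = 0.
Proof. by rewrite /normalized set0I mu0 mul0e. Qed.

Lemma normalized_le1 : normalized mu B B <= 1.
Proof.
rewrite /normalized setIid; have [->|ne] := eqVneq (mu B) +oo.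
  by rewrite /= invr0 mule0.
have bf : mu B \is a fin_num by rewrite ge0_fin_numE// lt_neqAle ne leey.
rewrite -{1}(fineK bf) -EFinM lee_fin.
have [->|x0] := eqVneq (fine (mu B)) 0%R; first by rewrite mul0r.
by rewrite divff.
Qed.

Lemma normalized_superadd :
  (forall A A', A `&` A' = set0 -> mu A + mu A' <= mu (A `|` A')) ->
  forall A A', A `&` A' = set0 ->
  normalized mu B A + normalized mu B A' <= normalized mu B (A `|` A').
Proof.
move=> h A A' AA; rewrite /normalized -ge0_muleDl// setIUl.
rewrite lee_wpmul2r// ?lee_fin ?invr_ge0 ?fine_ge0//.
by apply: h; rewrite setIACA AA set0I.
Qed.

End Normalized.

(** The normalization gives D mass at most 1, including the case of infinite
    Lebesgue measure, where [fine] makes the mass 0. *)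
Lemma integral_volume_le n (D : set (Cn R n)) (f : CnB R n -> \bar R) (c : R) :
  (0 <= c)%R -> (forall x, D x -> 0 <= f x) -> (forall x, D x -> f x <= c%:E) ->
  \int[volume D]_(x in D) f x <= c%:E.
Proof.
move=> c0 f0 fc.
apply: (@le_trans _ _ (c%:E * volume D D)).
  apply: integral_le_cst => //.
  - exact: normalized0 (lebesgueC0 n).
  - by move=> A; apply: normalized_ge0; exact: lebesgueC_ge0.
  - move=> A B AB; apply: normalized_superadd => //; first exact: lebesgueC_ge0.
    exact: lebesgueC_superadd.
rewrite -[leRHS]mule1 lee_wpmul2l ?lee_fin//.
by apply: normalized_le1; exact: lebesgueC_ge0.
Qed.

End LebesgueC.

Section Hausdorff.
Variables (R : realType) (n : nat).
Local Open Scope ereal_scope.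

Lemma hausdorff_ge0 s (A : set (Cn R n)) : 0 <= hausdorff s A.
Proof.
apply: (@le_trans _ _ (hausdorff_pre s 1 A)).
  apply: le_ereal_inf_tmp => _ [V [_ _ ->]].
  by apply: nneseries_ge0 => k _ _; rewrite expe_ge0// ediam_ge0.
by apply: ereal_sup_ubound; exists 1%R => //=; exact: ltr01.
Qed.

Lemma hausdorff0 s : (0 < s)%N -> hausdorff s (set0 : set (Cn R n)) = 0.
Proof.
move=> s0; apply/eqP; rewrite eq_le hausdorff_ge0 andbT.
apply: ge_ereal_sup => _ [d /= d0 <-].
have := @hausdorff_pre_finite R n void (fun=> set0) set0 0 d s s0 (lexx _) (ltW d0).
rewrite card_void mul0r; apply => //.
Qed.

Lemma hausdorff_mono s (A B : set (Cn R n)) : A `<=` B ->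
  hausdorff s A <= hausdorff s B.
Proof.
move=> AB; apply: ge_ereal_sup => _ [d /= d0 <-].
apply: (@le_trans _ _ (hausdorff_pre s d B)).
  apply: le_ereal_inf => _ [V [BV dV ->]]; exists V; split => //.
  exact: subset_trans BV.
by apply: ereal_sup_ubound; exists d.
Qed.

(** The upper bound C for the whole frontier bounds the normalizing constant; the
    lower bound a makes it nonzero. *)
Lemma surface_ge (G A : set (Cn R n)) (a C : R) : (0 < a)%R ->
  A `<=` frontier G -> a%:E <= hausdorff n.*2.-1 A ->
  hausdorff n.*2.-1 (frontier G) <= C%:E -> (a / C)%:E <= surface G A.
Proof.
move=> a0 AG aA GC; rewrite /surface /normalized (setIidl AG).
have AGm := hausdorff_mono n.*2.-1 AG.
set H := hausdorff _ (frontier G) in GC AGm *.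
have Hf : H \is a fin_num.
  rewrite ge0_fin_numE; first by apply: le_lt_trans GC _; rewrite ltry.
  exact: hausdorff_ge0.
have aH : (a <= fine H)%R by rewrite -lee_fin fineK//; exact: le_trans AGm.
have HC : (fine H <= C)%R by rewrite -lee_fin fineK.
have H0 : (0 < fine H)%R by apply: lt_le_trans aH.
rewrite EFinM; apply: lee_pmul; rewrite ?lee_fin ?invr_ge0 ?(ltW a0)//.
  by rewrite ltW// (lt_le_trans H0).
by rewrite lef_pV2 ?posrE// (lt_le_trans H0).
Qed.

End Hausdorff.

(** * Growth of functions of finite mixed norm *)

Section HolomorphicBoxes.
Variables (R : realType) (n : nat) (D : set (Cn R n)) (f : Cn R n -> R[i]).
Hypothesis fD : holomorphic_on D f.
Implicit Types z w u : Cn R n.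

Lemma cdiff_along z u (t : R[i]) : D (z + t *: u) ->
  cdiff (fun s => f (z + s *: u)) t.
Proof.
move=> Dz; apply: derivable_cdiff; apply: diff_derivable.
apply: (@differentiable_comp _ _ (Cn R n) _
  (fun s : R[i]^o => z + s *: u) (f : Cn R n -> R[i]^o) t); last exact: fD.
apply: differentiableD; first exact: differentiable_cst.
exact: ex_diff.
Qed.

Lemma crd_scale_le (t : R[i]) u i (r : R) : `|Re t| <= r -> `|Im t| <= r ->
  (forall i, `|crd u i| <= 1) -> `|crd (t *: u) i| <= 2 * r.
Proof.
move=> t1 t2 u1; have r0 : 0 <= r by apply: le_trans t1.
have b (x y : R) : `|x| <= r -> `|y| <= 1 -> `|x * y| <= r.
  by move=> xr y1; rewrite normrM -[leRHS]mulr1 ler_pM.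
have h1 := u1 (i.1, false); have h2 := u1 (i.1, true).
rewrite /crd /= in h1 h2.
rewrite /crd mxE mulr_natl mulr2n.
case: i h1 h2 => j [] /=; case: t t1 t2 => x y /= t1 t2; case: (u 0 j) => a c /= h1 h2.
  by apply: le_trans (ler_normD _ _) _; apply: lerD; apply: b.
by apply: le_trans (ler_normB _ _) _; apply: lerD; apply: b.
Qed.

(** Restriction to the complex line through z and w, parametrized so that w is
    reached at the real parameter d'. *)
Lemma holomorphic_box_lipschitz z (d A : R) : 0 < d ->
  (forall w, near_box d z w -> D w /\ cmod (f w) <= A) ->
  forall d' w, 0 < d' -> d' <= d / 8 -> near_box d' z w ->
    cmod (f w - f z) <= 128 * A / d * d'.
Proof.
move=> d0 H d' w d'0 d'd zw.
pose u := (d'^-1)%:C *: (w - z).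
have ReZ (a : R) (x : R[i]) : Re (a%:C * x) = a * Re x by case: x => ? ? /=; ring.
have ImZ (a : R) (x : R[i]) : Im (a%:C * x) = a * Im x by case: x => ? ? /=; ring.
have u1 i : `|crd u i| <= 1.
  have -> : crd u i = d'^-1 * crd (w - z) i.
    by rewrite /crd /u mxE; case: ifP => _; rewrite ?ReZ ?ImZ.
  rewrite normrM gtr0_norm ?invr_gt0// ler_pdivrMl// mulr1 crdB.
  exact: ltW.
pose r := d / 4; have r0 : 0 < r by rewrite divr_gt0.
pose g (t : R[i]) := f (z + t *: u).
have gM t : `|Re (t - 0)| <= r -> `|Im (t - 0)| <= r -> cdiff g t /\ cmod (g t) <= A.
  rewrite subr0 => t1 t2.
  have zb : near_box d z (z + t *: u).
    move=> i; rewrite -crdB addrC addKr.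
    by apply: le_lt_trans (crd_scale_le i t1 t2 u1) _; rewrite /r; lra.
  have [Dz fA] := H _ zb; split => //; exact: cdiff_along.
have dr : d' <= r / 2 by rewrite /r; lra.
have Red : `|Re d'%:C| <= r / 2 by rewrite /= gtr0_norm.
have Imd : `|Im d'%:C| <= r / 2 by rewrite /= normr0 divr_ge0// ltW.
have := bounded_cdiff_lipschitz r0 gM Red Imd.
rewrite add0r /g scale0r addr0 scalerA -rmorphM divff ?gt_eqF// rmorph1 scale1r.
rewrite (addrC z) subrK cmod_real gtr0_norm// => h.
apply: le_trans h _; rewrite /r.
by rewrite le_eqVlt; apply/orP; left; apply/eqP; field; rewrite gt_eqF.
Qed.

Lemma holomorphic_locally_bounded z : D z ->
  exists2 d : R, 0 < d & forall w, near_box d z w -> cmod (f w) <= cmod (f z) + 1.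
Proof.
move=> Dz; have fc := differentiable_continuous (fD Dz).
have : \forall w \near z, `|f z - f w| < (1 : R[i]).
  move: fc => /cvgrPdist_lt; apply; exact: ltr01.
move=> /nbhs_boxP[d d0 dh]; exists d => // w /dh; rewrite cmodE ltcR => h.
rewrite -(subrK (f z) (f w)) addrC; apply: le_trans (cmodD _ _) _.
by rewrite lerD2l cmodB ltW.
Qed.

End HolomorphicBoxes.

Section PowerAlgebra.
Variable R : realType.

(** With X = |f z|/2, the right-hand side is the lower bound for the q-th power of the
    mixed norm that a box of size d provides. Up to a constant it is
    X^q d^((beta + m) q / p + 1), and the exponent of d is at most N q with d <= 1. *)
Lemma power_absorb (p q beta a b C0 : R) (m N : nat) :
  0 < p -> 0 < q -> 0 < a -> 0 < b -> 0 < C0 ->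
  (beta + m%:R) / p * q + 1 <= N%:R * q ->
  exists2 k : R, 0 < k & forall X d : R, 0 <= X -> 0 < d -> d <= 1 ->
    k * (X * d ^+ N) `^ q <=
      ((d / 2) `^ beta * (X `^ p * ((a * d) ^+ m / C0))) `^ (q / p) * (b * d).
Proof.
move=> p0 q0 a0 b0 C00 hN.
pose c1 : R := (2^-1) `^ beta * (a ^+ m / C0).
have c10 : 0 < c1 by rewrite mulr_gt0 ?powR_gt0 ?invr_gt0// divr_gt0// exprn_gt0.
exists (c1 `^ (q / p) * b); first by rewrite mulr_gt0 ?powR_gt0.
move=> X d X0 d0 d1.
have dn : 0 <= d by exact: ltW.
have -> : (d / 2) `^ beta * (X `^ p * ((a * d) ^+ m / C0)) =
    c1 * (X `^ p * d `^ (beta + m%:R)).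
  rewrite powRM ?invr_ge0// powRD ?(gt_eqF d0) ?implybT// powR_mulrn// exprMn /c1.
  by ring.
rewrite (powRM _ (ltW c10)) ?mulr_ge0 ?powR_ge0//.
rewrite (powRM _ (powR_ge0 _ _) (powR_ge0 _ _)) -!powRrM.
rewrite (powRM _ X0) ?exprn_ge0// -powR_mulrn// -powRrM.
have -> : p * (q / p) = q by field; rewrite gt_eqF.
have -> : c1 `^ (q / p) * (X `^ q * d `^ ((beta + m%:R) * (q / p))) * (b * d) =
    c1 `^ (q / p) * b * (X `^ q * (d `^ ((beta + m%:R) * (q / p)) * d)) by ring.
rewrite ler_wpM2l ?mulr_ge0 ?powR_ge0 ?(ltW b0)// ler_wpM2l ?powR_ge0//.
rewrite -[Y in _ <= _ * Y](powRr1 dn) -powRD ?(gt_eqF d0) ?implybT//.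
apply: ger_powR; first by rewrite d0.
by apply: le_trans hN; rewrite mulrA mulrAC.
Qed.

Lemma le_powR_inv (Y q k J : R) : 0 <= Y -> 0 < q -> 0 < k ->
  k * Y `^ q <= J -> Y <= (J / k) `^ q^-1.
Proof.
move=> Y0 q0 k0 h.
have qi : 0 <= q^-1 by rewrite invr_ge0 ltW.
rewrite -[leLHS](powRr1 Y0) -(@divff _ q) ?gt_eqF// powRrM.
apply: ge0_ler_powR; rewrite ?nnegrE ?powR_ge0//.
  apply: divr_ge0; last exact: ltW.
  by apply: le_trans h; rewrite mulr_ge0 ?powR_ge0// ltW.
by rewrite ler_pdivlMr// mulrC.
Qed.

End PowerAlgebra.

Section Growth.
Variables (R : realType) (n : nat) (D U : set (Cn R n)) (rho : Cn R n -> R).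
Hypotheses (n_gt0 : (0 < n)%N) (Dbd : ebounded D) (Dop : open D)
  (df : defining_function D U rho).
Variables (e L C0 : R).
Hypotheses (rs : regular_scale D U rho e L) (C0_gt0 : 0 < C0)
  (HC0 : forall r, 0 < r -> r <= e ->
     (hausdorff n.*2.-1 (frontier (level_domain D rho r)) <= C0%:E)%E).
Variables (r0 p q beta : R).
Hypotheses (r0_gt0 : 0 < r0) (p0 : 0 < p) (q0 : 0 < q) (beta0 : 0 < beta).
Variable (f : Cn R n -> R[i]).
Implicit Types (z w : Cn R n).

Lemma open_near_box (d : R) z : 0 < d -> open [set w | near_box d z w].
Proof.
move=> d0; rewrite openE => w zw.
apply/nbhs_boxP.
have [s [s0 sP]] : exists s, 0 < s /\ forall i, `|crd w i - crd z i| + s <= d.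
  exists (d - \big[Num.max/0]_i `|crd w i - crd z i|); split.
    rewrite subr_gt0; apply/bigmax_ltP; split => // i _; exact: zw.
  move=> i; rewrite addrCA gerDl subr_le0; exact: le_bigmax.
exists s => // v wv i; apply: lt_le_trans (sP i).
rewrite -(subrKA (crd w i)) addrC.
by apply: le_lt_trans (ler_normD _ _) _; rewrite ltrD2l wv.
Qed.

Lemma measurable_frontier_box A (d : R) z : 0 < d ->
  measurable ((frontier A `&` [set w | near_box d z w]) : set (CnB R n)).
Proof.
move=> d0; apply: measurableI; last first.
  by apply: sub_sigma_algebra; exact: open_near_box.
rewrite /frontier setDE; apply: measurableI.
  rewrite -[X in measurable X]setCK; apply: measurableC; apply: sub_sigma_algebra.
  by rewrite /= openC; exact: closed_closure.
by apply: measurableC; apply: sub_sigma_algebra; exact: open_interior.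
Qed.

(** The part of the level set that lies in the box carries a definite share of the
    normalized surface measure. *)
Lemma level_integral_lower z d (X r : R) : D z -> rho z <= e -> 0 < d -> d <= e ->
  0 <= X -> (forall w, near_box d z w -> X <= cmod (f w)) ->
  0 < r -> rho z - e * d / 4 <= r -> r <= rho z ->
  ((X `^ p * ((e * d / (4 * L)) ^+ n.*2.-1 / C0))%:E <=
   \int[surface (level_domain D rho r)]_(z in frontier (level_domain D rho r))
     ((cmod (f z)) `^ p)%:E)%E.
Proof.
move=> Dz rz d0 de X0 Xf r0' r1 r2.
have e0 := rs_pos rs; have L1 := rs_leL rs.
pose a := (e * d / (4 * L)) ^+ n.*2.-1.
have a0 : 0 < a by rewrite exprn_gt0// divr_gt0 ?mulr_gt0//; lra.
pose A := frontier (level_domain D rho r) `&` [set w | near_box d z w].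
have AF : A `<=` frontier (level_domain D rho r) by move=> w [].
have low := level_hausdorff_lower df rs Dz rz d0 de r0' r1 r2.
have re : r <= e by apply: le_trans rz.
have sA := surface_ge a0 AF low (HC0 r0' re).
apply: (@le_trans _ _ ((X `^ p)%:E * surface (level_domain D rho r) A)%E).
  by rewrite EFinM lee_wpmul2l// lee_fin powR_ge0.
apply: integral_ge_cst.
- by apply: normalized0; apply: hausdorff0; move: n_gt0; case: (n).
- exact: powR_ge0.
- exact: measurable_frontier_box.
- exact: AF.
- by move=> x _; rewrite lee_fin powR_ge0.
- move=> x [_ zx]; rewrite lee_fin ge0_ler_powR ?nnegrE ?cmod_ge0//; first exact: ltW.
  exact: Xf.
Qed.

(** Only the levels in the interval [rho z - e d / 4, rho z] are used; there the
    integrand is bounded below by a constant. *)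
Lemma pqnorm_lower z d (X a : R) : D z -> rho z <= e -> rho z <= r0 ->
  0 < d -> d <= e -> 0 <= X -> (forall w, near_box d z w -> X <= cmod (f w)) ->
  0 < a -> a <= rho z - e * d / 4 ->
  (((a `^ beta * (X `^ p * ((e * d / (4 * L)) ^+ n.*2.-1 / C0))) `^ (q / p)
     * (e * d / 4))%:E <=
   \int[@lebesgue_measure R]_(r in `]0%R, r0])
     (((r `^ beta)%:E *
       \int[surface (level_domain D rho r)]_(z in frontier (level_domain D rho r))
         ((cmod (f z)) `^ p)%:E) `^ (q / p) * (r^-1)%:E))%E.
Proof.
move=> Dz rz rzr0 d0 de X0 Xf a0 az.
have e0 := rs_pos rs; have L1 := rs_leL rs; have e1 := rs_le1 rs.
have ed0 : 0 < e * d / 4 by rewrite divr_gt0 ?mulr_gt0.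
rewrite EFinM; have -> : (e * d / 4)%:E = @lebesgue_measure R `[rho z - e * d / 4, rho z].
  rewrite lebesgue_measure_itv /= lte_fin ifT; last by lra.
  by rewrite -EFinD opprB addrC subrK.
apply: integral_ge_cst.
- exact: measure0.
- exact: powR_ge0.
- exact: measurable_itv.
- by move=> r /=; rewrite !in_itv /= => /andP[h1 h2]; apply/andP; split; lra.
- move=> r /=; rewrite in_itv /= => /andP[h1 _]; apply: mule_ge0; first exact: poweR_ge0.
  by rewrite lee_fin invr_ge0 ltW.
move=> r /=; rewrite in_itv /= => /andP[h1 h2].
have rpos : 0 < r by apply: lt_le_trans a0 _; exact: le_trans h1.
have low := level_integral_lower Dz rz d0 de X0 Xf rpos h1 h2.
set J := integral _ _ _ in low *.
have L0 : 0 < L by lra.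
set B := (X `^ p * ((e * d / (4 * L)) ^+ n.*2.-1 / C0)) in low *.
have B0 : 0 <= B.
  apply: mulr_ge0; first exact: powR_ge0.
  apply: divr_ge0; last exact: ltW.
  by apply: exprn_ge0; apply: divr_ge0; apply: mulr_ge0 => //; exact: ltW.
have J0 : (0 <= J)%E by apply: le_trans low; rewrite lee_fin.
have ra : a `^ beta <= r `^ beta.
  by apply: ge0_ler_powR; rewrite ?nnegrE ?(ltW a0) ?(ltW rpos) ?(ltW beta0)//; exact: le_trans h1.
apply: (@le_trans _ _ (((r `^ beta)%:E * J) `^ (q / p))%E).
  rewrite -[leLHS]/((a `^ beta * B)%:E `^ (q / p))%E; apply: gt0_ler_poweR.
  - by rewrite divr_ge0 ?ltW.
  - by rewrite in_itv /= leey andbT lee_fin mulr_ge0 ?powR_ge0.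
  - by rewrite in_itv /= leey andbT mule_ge0 ?lee_fin ?powR_ge0.
  - by rewrite EFinM; apply: lee_pmul; rewrite ?lee_fin ?powR_ge0.
rewrite -[leLHS]mule1; apply: lee_wpmul2l; first exact: poweR_ge0.
by rewrite lee_fin invf_ge1//; apply: le_trans h2 _; lra.
Qed.

Hypotheses (fD : holomorphic_on D f) (fpq : (pqnorm D rho r0 p q beta f < +oo)%E).

Lemma pqnorm_integral_fin : exists2 J : R, 0 <= J &
  (\int[@lebesgue_measure R]_(r in `]0%R, r0])
     (((r `^ beta)%:E *
       \int[surface (level_domain D rho r)]_(z in frontier (level_domain D rho r))
         ((cmod (f z)) `^ p)%:E) `^ (q / p) * (r^-1)%:E) = J%:E)%E.
Proof.
move: fpq; rewrite /pqnorm; set I := integral _ _ _ => h.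
have I0 : (0 <= I)%E.
  apply: integral_ge0 => r /=; rewrite in_itv /= => /andP[h1 _].
  by apply: mule_ge0; [exact: poweR_ge0|rewrite lee_fin invr_ge0 ltW].
have If : (I < +oo)%E by apply: lty_poweRy h; rewrite invr_eq0 gt_eqF.
exists (fine I); first exact: fine_ge0.
by rewrite fineK// ge0_fin_numE.
Qed.

Lemma rho_lt1 z : D z -> rho z < 1.
Proof. exact: (df_lt1 df). Qed.

(** The supremum of |f| (rho - eps)^N over the points at which rho >= eps is
    nearly attained at some z, which makes |f| comparable to |f z| on a box of
    size proportional to rho z - eps. The norm then controls |f z|, with a
    constant independent of eps. *)
Lemma growth_bound (N : nat) : (beta + (n.*2.-1)%:R) / p * q + 1 <= N%:R * q ->
  exists2 K : R, 0 <= K & forall w, D w -> cmod (f w) * rho w ^+ N <= K.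
Proof.
move=> hN.
have e0 := rs_pos rs; have L1 := rs_leL rs; have e1 := rs_le1 rs.
have L0 : 0 < L by lra.
have [J J0 JE] := pqnorm_integral_fin.
(* on a box of size s1 d, rho varies by at most d/2 *)
pose s1 : R := e / (2 * L).
have s10 : 0 < s1 by rewrite divr_gt0 ?mulr_gt0.
have s11 : s1 <= e / 2.
  by rewrite /s1 ler_pdivrMr ?mulr_gt0//; nra.
(* on a box of size k2 d, f varies by at most |f z|/4: the Lipschitz bound is
   128 * 2^(N+1) |f z| / (s1 d) *)
pose k2 : R := s1 / (512 * 2 ^+ N.+1).
have pN : 1 <= 2 ^+ N.+1 :> R by rewrite exprn_ege1// ler1n.
have den0 : 0 < 512 * 2 ^+ N.+1 :> R by lra.
have k20 : 0 < k2 by rewrite divr_gt0.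
have k2s : k2 <= s1 / 8.
  rewrite /k2 ler_pdivrMr//; nra.
have ek1 : 0 < e * k2 / (4 * L) by apply: divr_gt0; exact: mulr_gt0.
have ek2 : 0 < e * k2 / 4 by apply: divr_gt0 => //; exact: mulr_gt0.
have [k k0 hk] := @power_absorb R p q beta (e * k2 / (4 * L)) (e * k2 / 4) C0
  n.*2.-1 N p0 q0 ek1 ek2 C0_gt0 hN.
pose K2 : R := 2 * (J / k) `^ q^-1.
have K20 : 0 <= K2 by rewrite mulr_ge0 ?powR_ge0.
pose r1 := Num.min e r0.
have r10 : 0 < r1 by rewrite lt_min e0.
have cl_D z : closure D z -> 0 < rho z -> D z.
  by move=> cz; apply: (D_of_rho df); exact: (df_nbhs df cz).
(* away from the boundary f is bounded by compactness *)
have bounded_above (c : R) : 0 < c -> exists2 B : R, 0 <= B &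
    forall z, D z -> c <= rho z -> cmod (f z) <= B.
  move=> c0.
  have [b b0 bP] : exists2 b : R, 0 < b & forall z, closure D z ->
      c <= rho z -> cmod (f z) <= b^-1.
    apply: (compact_scale (compact_closure Dbd)).
      move=> b b' z b'0 b'b H cz; apply: le_trans (H cz) _.
      by rewrite lef_pV2 ?posrE// (lt_le_trans b'0).
    move=> z cz; have [Dz|nDz] := pselect (D z).
      have [d d0 dP] := holomorphic_locally_bounded fD Dz.
      have f1 : 0 < cmod (f z) + 1 by rewrite ltr_wpDl ?cmod_ge0.
      exists (Num.min d (cmod (f z) + 1)^-1); first by rewrite lt_min d0 invr_gt0.
      move=> w zw _ _; apply: le_trans (dP w _) _.
        by apply: near_box_le zw; rewrite ge_min lexx.
      rewrite -[leLHS]invrK lef_pV2 ?posrE ?invr_gt0 ?lt_min ?d0 ?invr_gt0//.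
      by rewrite ge_min lexx orbT.
    have rz : rho z <= 0 by rewrite leNgt; apply/negP => /(cl_D z cz).
    have Uz := df_nbhs df cz.
    have /continuous_boxP/(_ c c0)[d d0 dP] := rho_continuous df Uz.
    exists d => // w zw _ cw; exfalso.
    by have := dP w zw; rewrite ltr_norml => /andP[_]; lra.
  exists b^-1; first by rewrite invr_ge0 ltW.
  by move=> z Dz; apply: bP; exact: subset_closure.
have [K1 K10 K1P] := bounded_above r1 r10.
pose K := 2 * (K1 + K2).
have K0 : 0 <= K by rewrite mulr_ge0 ?addr_ge0.
suff main (eps : R) w : 0 < eps -> D w -> eps <= rho w ->
    cmod (f w) * (rho w - eps) ^+ N <= K.
  exists (2 ^+ N * K); first by rewrite mulr_ge0// exprn_ge0.
  move=> w Dw; have rw := rho_gt0 df Dw.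
  have := main (rho w / 2) w ltac:(lra) Dw ltac:(lra).
  have -> : rho w - rho w / 2 = rho w / 2 by field.
  rewrite expr_div_n mulrA ler_pdivrMr ?exprn_gt0// [K * _]mulrC.
  exact.
move=> eps0 Dw epsw.
pose phi z := cmod (f z) * (rho z - eps) ^+ N.
have [B B0 BP] := bounded_above eps eps0.
pose S := [set phi z | z in [set z | D z /\ eps <= rho z]].
have phi_le z : D z -> eps <= rho z -> phi z <= B.
  move=> Dz ez; have := rho_lt1 Dz => z1.
  rewrite /phi -[leRHS]mulr1 ler_pM ?cmod_ge0 ?exprn_ge0 ?subr_ge0 ?BP//.
  by rewrite exprn_ile1 ?subr_ge0//; lra.
have hS : has_sup S.
  split; first by exists (phi w); exists w.
  by exists B => _ [z [Dz ez] <-]; exact: phi_le.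
have supP z : D z -> eps <= rho z -> phi z <= sup S.
  by move=> Dz ez; apply: (ub_le_sup hS.2); exists z.
have [sle|sgt] := leP (sup S) 0; first exact: le_trans (supP w Dw epsw) (le_trans sle K0).
have [_ [z [Dz ez] <-] zsup] := sup_adherent (divr_gt0 sgt (ltr0n R 2)) hS.
have {zsup} zmax : sup S <= 2 * phi z by lra.
apply: le_trans (supP w Dw epsw) _; apply: (le_trans zmax); rewrite ler_wpM2l//.
pose d := rho z - eps.
have z1 := rho_lt1 Dz.
have phi_gt0 : 0 < phi z by lra.
have Npos : (0 < N)%N.
  rewrite lt0n; apply/eqP => N0; move: hN; rewrite N0 mul0r leNgt => /negP; apply.
  rewrite ltr_wpDl//; apply: mulr_ge0; last exact: ltW.
  by apply: divr_ge0; [apply: addr_ge0 => //; exact: ltW|exact: ltW].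
have d0 : 0 < d.
  rewrite lt_def subr_ge0 ez andbT; apply/eqP => dz; move: phi_gt0.
  by rewrite /phi -/d dz expr0n eqn0Ngt Npos mulr0 ltxx.
have d1 : d <= 1 by rewrite /d; lra.
have dN1 : d ^+ N <= 1 by rewrite exprn_ile1// ltW.
have [zr1|zr1] := leP r1 (rho z).
  rewrite /phi -/d; apply: (@le_trans _ _ K1); last by rewrite lerDl.
  rewrite -[leRHS]mulr1; apply: ler_pM; rewrite ?cmod_ge0 ?exprn_ge0 ?(ltW d0)//.
  exact: K1P.
have ze : rho z <= e by apply: le_trans (ltW zr1) _; rewrite ge_min lexx.
have zr0 : rho z <= r0 by apply: le_trans (ltW zr1) _; rewrite ge_min lexx orbT.
have cz : closure D z by exact: subset_closure.
pose s := s1 * d.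
have s0 : 0 < s by rewrite mulr_gt0.
have ss1 : s <= s1 by rewrite /s ler_piMr// ltW.
have se : s <= e / 2 by apply: le_trans s11.
pose A := 2 ^+ N.+1 * cmod (f z).
have boxs v : near_box s z v -> D v /\ cmod (f v) <= A.
  move=> zv.
  have zv' : near_box e z v by apply: near_box_le zv; lra.
  have Ls : L * s = e * d / 2 by rewrite /s /s1; field; rewrite gt_eqF.
  have dv : `|rho v - rho z| <= d / 2.
    apply: (@le_trans _ _ (L * s)).
      by apply: (rs_lip rs cz zv' (near_box_refl z e0)) => i; exact: ltW (zv i).
    rewrite Ls ler_pM2r//.
    by rewrite ler_piMl// ltW.
  have vd : d / 2 <= rho v - eps by move: dv; rewrite ler_norml /d; lra.
  have Dv : D v by apply: (D_of_rho df); [exact: (rs_U rs cz zv')|lra].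
  split => //.
  have h1 := supP v Dv ltac:(lra).
  have h2 : cmod (f v) * (d / 2) ^+ N <= 2 * (cmod (f z) * d ^+ N).
    apply: le_trans zmax; apply: le_trans h1; rewrite /phi ler_wpM2l ?cmod_ge0//.
    have d20 : 0 <= d / 2 by rewrite divr_ge0// ltW.
    by apply: lerXn2r => //; rewrite nnegrE //; exact: le_trans vd.
  move: h2; rewrite expr_div_n (mulrA (cmod (f v))) ler_pdivrMr ?exprn_gt0//.
  have -> : 2 * (cmod (f z) * d ^+ N) * 2 ^+ N = A * d ^+ N.
    by rewrite /A exprS; ring.
  by rewrite ler_pM2r// exprn_gt0.
pose t := k2 * d.
have t0 : 0 < t by rewrite mulr_gt0.
have ts : t <= s / 8.
  have -> : s / 8 = s1 / 8 * d by rewrite /s; ring.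
  by apply: ler_wpM2r => //; exact: ltW.
have boxt v : near_box t z v -> cmod (f z) / 2 <= cmod (f v).
  move=> zv; have := holomorphic_box_lipschitz fD s0 boxs t0 ts zv.
  have -> : 128 * A / s * t = cmod (f z) / 4.
    by rewrite /A /s /t /k2; field; rewrite !gt_eqF// exprn_gt0.
  have := cmodD (f z - f v) (f v); rewrite subrK cmodB => h1 h2.
  by have := cmod_ge0 (f z); lra.
have te : t <= e by lra.
have az : d / 2 <= rho z - e * t / 4.
  have : e * t <= t by rewrite ler_piMl// ltW.
  have : t <= d by rewrite /t ler_piMl ?(ltW d0)//; lra.
  by rewrite /d in d0 *; lra.
have fz0 : 0 <= cmod (f z) / 2 by rewrite divr_ge0// cmod_ge0.
have := @pqnorm_lower z t (cmod (f z) / 2) (d / 2) Dz ze zr0 t0 te fz0 boxt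
  ltac:(lra) az.
rewrite JE lee_fin => low.
have := hk (cmod (f z) / 2) d fz0 d0 d1.
have E1 : e * k2 / (4 * L) * d = e * t / (4 * L) by rewrite /t; ring.
have E2 : e * k2 / 4 * d = e * t / 4 by rewrite /t; ring.
rewrite E1 E2 => /le_trans/(_ low) hJ.
have Y0 : 0 <= cmod (f z) / 2 * d ^+ N by rewrite mulr_ge0// exprn_ge0// ltW.
have hY := le_powR_inv Y0 q0 k0 hJ.
rewrite /phi -/d; apply: (@le_trans _ _ K2); last by rewrite lerDr.
by move: hY; rewrite /K2 mulrAC; lra.
Qed.

End Growth.

(** * Reproduction of the functions of finite mixed norm *)

Lemma near_eq_differentiable (K : numFieldType) (V W : normedModType K)
    (f g : V -> W) (a : V) :
  (\forall x \near a, f x = g x) -> differentiable f a -> differentiable g a.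
Proof.
move=> fg fa; have [fc fo] := (diff_locallyP a f).1 fa.
have fga : f a = g a by exact: nbhs_singleton fg.
have go : g \o shift a = cst (g a) + 'd f a +o_ 0 id.
  apply/eqaddoP => e e0; move/eqaddoP: fo => /(_ e e0) fo.
  have fg0 : \forall h \near (0 : V), f (h + a) = g (h + a).
    by move: fg; rewrite (near_shift 0 a) /= subr0.
  near=> h.
  have -> : (g \o shift a - (cst (g a) + 'd f a)) h =
            (f \o shift a - (cst (f a) + 'd f a)) h.
    by rewrite /= !fctE /= fga (near fg0 h).
  by near: h.
apply/diff_locallyP; rewrite (diff_unique fc go); split => //.
Unshelve. all: by end_near. Qed.

Section Measurability.
Variables (R : realType) (n : nat) (D : set (Cn R n)).
Hypothesis Dop : open D.

Lemma measurable_open_CnB : measurable (D : set (CnB R n)).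
Proof. exact: sub_sigma_algebra. Qed.

Lemma measurable_continuous (u : Cn R n -> R) :
  (forall z, D z -> {for z, continuous u}) ->
  measurable_fun (D : set (CnB R n)) (u : CnB R n -> R).
Proof.
move=> uc; apply: (measurability _ (RGenOInfty.measurableE R)).
move=> _ [_ [x ->] <-]; apply: sub_sigma_algebra.
rewrite /= openE => z [Dz /=]; rewrite in_itv /= andbT => xu.
have nD : nbhs z D by apply: open_nbhs_nbhs.
have d0 : 0 < u z - x by rewrite subr_gt0.
apply: filterS (filterI nD (nbhs_box_lt (uc z Dz) d0)) => v [Dv].
rewrite ltr_norml => /andP[h _]; split => //=; rewrite in_itv /= andbT; lra.
Qed.

End Measurability.

Section Slices.
Variables (R : realType) (n : nat).
Implicit Types (w z : Cn R n) (F : Cn R n -> Cn R n -> R[i]).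

Lemma near_box_row_mx w z z' d : 0 < d -> near_box d z z' ->
  near_box d (row_mx w z : Cn R (n + n)) (row_mx w z').
Proof.
move=> d0 zz [j b]; rewrite /crd !mxE /=; case: splitP => k _.
  by rewrite subrr normr0.
exact: (zz (k, b)).
Qed.

Lemma csmooth_slice (A : set (Cn R n)) F w z :
  csmooth_on (setXX A) (uncurry2 F) -> A w -> A z ->
  {for z, continuous (fun v => Re (F w v))} /\
  {for z, continuous (fun v => Im (F w v))}.
Proof.
move=> [sR sI] Aw Az.
have XX : setXX A (row_mx w z) by rewrite /setXX /= row_mxKl row_mxKr.
have aux (G : Cn R (n + n) -> R) (g : Cn R n -> R) :
    (forall v, G (row_mx w v) = g v) ->
    {for row_mx w z, continuous G} -> {for z, continuous g}.
  move=> Gg /continuous_boxP h; apply/continuous_boxP => e e0.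
  have [d d0 dh] := h e e0; exists d => // v zv.
  by rewrite -!Gg; apply: dh; exact: near_box_row_mx.
split.
- apply: (aux _ _ _ ((sR 0%N).1 _ XX)) => v.
  by rewrite /uncurry2 row_mxKl row_mxKr.
- apply: (aux _ _ _ ((sI 0%N).1 _ XX)) => v.
  by rewrite /uncurry2 row_mxKl row_mxKr.
Qed.

Lemma holomorphic_continuous (D : set (Cn R n)) (f : Cn R n -> R[i]) z :
  holomorphic_on D f -> D z ->
  {for z, continuous (fun v => Re (f v))} /\ {for z, continuous (fun v => Im (f v))}.
Proof.
move=> fD Dz; have fc := differentiable_continuous (fD z Dz).
have key (e : R) : 0 < e -> exists2 d : R, 0 < d &
    forall w, near_box d z w -> cmod (f w - f z) < e.
  move=> e0; have : \forall w \near z, `|f z - f w| < (e%:C : R[i]).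
    by move: fc => /cvgrPdist_lt; apply; rewrite ltcR.
  move=> /nbhs_boxP[d d0 dh]; exists d => // w /dh.
  by rewrite cmodE ltcR cmodB.
split; apply/continuous_boxP => e /key[d d0 dh]; exists d => // w /dh; apply: le_lt_trans.
  by rewrite -ReB normRe_le.
by rewrite -ImB normIm_le.
Qed.

End Slices.

Section KernelBound.
Variables (R : realType) (n : nat) (D U : set (Cn R n)) (rho : Cn R n -> R).
Variables (Phi K : Cn R n -> Cn R n -> R[i]) (alpha : R).
Hypotheses (Dbd : ebounded D) (Dop : open D) (df : defining_function D U rho)
  (hr : henkin_ramirez D U rho Phi) (kt : kernel_of_type D Phi alpha K).

(** For a fixed interior point the denominator of the kernel stays away from 0 up
    to the boundary. *)
Lemma kernel_bounded w : D w ->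
  exists2 B : R, 0 <= B & forall z, D z -> cmod (K w z) <= B.
Proof.
move=> Dw; have Uw : U w by exact: (D_sub_U df).
have [d d0 dP] : exists2 d : R, 0 < d & forall z, closure D z -> d <= cmod (Phi w z).
  apply: (compact_scale (compact_closure Dbd)).
    by move=> e e' z _ e'e; exact: le_trans.
  move=> z cz; have Uz := df_nbhs df cz.
  have P0 : Phi w z != 0.
    apply/eqP => /(hr_zero hr (subset_closure Dw) cz)[wz [_ +]]; apply.
    by rewrite -wz; move: Dop; rewrite openE => /(_ _ Dw).
  have [cR cI] := csmooth_slice (hr_smooth hr) Uw Uz.
  pose m := cmod (Phi w z); have m0 : 0 < m by exact: cmod_gt0.
  have m4 : 0 < m / 4 by rewrite divr_gt0.
  have : nbhs z (fun v => `|Re (Phi w v) - Re (Phi w z)| < m / 4 /\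
                        `|Im (Phi w v) - Im (Phi w z)| < m / 4).
    exact: filterI (nbhs_box_lt cR m4) (nbhs_box_lt cI m4).
  move=> /nbhs_boxP[e e0 eh]; exists (Num.min e (m / 2)).
    by rewrite lt_min e0 divr_gt0.
  move=> v zv _; have [|h1 h2] := eh v.
    by apply: near_box_le zv; rewrite ge_min lexx.
  rewrite ge_min; apply/orP; right.
  have := cmodD (Phi w z - Phi w v) (Phi w v); rewrite subrK cmodB -/m.
  have := cmod_le_ReIm (Phi w v - Phi w z); rewrite ReB ImB; lra.
have [C1 C1P] := ker_bound kt.
have a0 : 0 < n%:R + 1 + alpha.
  by have := ker_type kt; have := ler0n R n; lra.
exists (`|C1| * d `^ (- (n%:R + 1 + alpha))); first by rewrite mulr_ge0 ?powR_ge0.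
move=> z Dz; apply: le_trans (C1P w z Dw Dz) _.
apply: (@le_trans _ _ (`|C1| * cmod (Phi w z) `^ (- (n%:R + 1 + alpha)))).
  by rewrite ler_wpM2r ?powR_ge0// ler_norm.
rewrite ler_wpM2l// !powRN.
have Pz := dP z (subset_closure Dz).
rewrite lef_pV2 ?posrE ?powR_gt0//; last by exact: lt_le_trans Pz.
by apply: ge0_ler_powR; rewrite ?nnegrE ?cmod_ge0//; exact: ltW.
Qed.

End KernelBound.

Section Reproduction.
Variables (R : realType) (n : nat) (D U : set (Cn R n)) (rho : Cn R n -> R).
Variables (Phi K : Cn R n -> Cn R n -> R[i]) (alpha : R).
Hypotheses (Dbd : ebounded D) (Dop : open D) (df : defining_function D U rho)
  (hr : henkin_ramirez D U rho Phi) (kt : kernel_of_type D Phi alpha K)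
  (rep : reproducing D rho alpha K).
Variables (f : Cn R n -> R[i]) (B : R).
Hypotheses (fD : holomorphic_on D f) (B_ge0 : 0 <= B)
  (fB : forall z, D z -> cmod (f z) * rho z `^ alpha <= B).

Lemma T_op_reproduces w : D w -> T_op D rho alpha K f w = f w.
Proof.
move=> Dw; rewrite [RHS](rep fD _ Dw).
  rewrite /T_op; congr cintegral; apply/funext => z.
  by rewrite /T_integrand (mulrC (f z)).
apply: (@le_lt_trans _ _ B%:E); last exact: ltry.
apply: integral_volume_le => // z _.
by rewrite lee_fin mulr_ge0 ?cmod_ge0 ?powR_ge0.
Qed.

Lemma T_integrand_integrable w : D w ->
  cintegrable (volume D) D (T_integrand rho alpha K f w).
Proof.
move=> Dw; have [BK BK0 BKP] := kernel_bounded Dbd Dop df hr kt Dw.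
have bound z : D z -> cmod (T_integrand rho alpha K f w z) <= BK * B.
  move=> Dz; rewrite /T_integrand !cmodM cmod_real ger0_norm ?powR_ge0// -mulrA.
  by apply: ler_pM; rewrite ?cmod_ge0 ?mulr_ge0 ?cmod_ge0 ?powR_ge0 ?BKP ?fB.
have BB0 : 0 <= BK * B by exact: mulr_ge0.
have mD := measurable_open_CnB Dop.
have mKR : measurable_fun (D : set (CnB R n)) ((fun z => Re (K w z)) : CnB R n -> R).
  apply: measurable_continuous => // z Dz.
  by have [] := csmooth_slice (ker_smooth kt) Dw Dz.
have mKI : measurable_fun (D : set (CnB R n)) ((fun z => Im (K w z)) : CnB R n -> R).
  apply: measurable_continuous => // z Dz.
  by have [] := csmooth_slice (ker_smooth kt) Dw Dz.
have mfR : measurable_fun (D : set (CnB R n)) ((fun z => Re (f z)) : CnB R n -> R).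
  by apply: measurable_continuous => // z Dz; have [] := holomorphic_continuous fD Dz.
have mfI : measurable_fun (D : set (CnB R n)) ((fun z => Im (f z)) : CnB R n -> R).
  by apply: measurable_continuous => // z Dz; have [] := holomorphic_continuous fD Dz.
have mrho : measurable_fun (D : set (CnB R n)) ((fun z => rho z `^ alpha) : CnB R n -> R).
  apply: (@measurableT_comp _ _ _ _ _ _ (@powR R ^~ alpha) _ (rho : CnB R n -> R)).
    exact: measurable_powR.
  by apply: measurable_continuous => // z Dz; apply: (rho_continuous df); exact: (D_sub_U df).
have ReT z : Re (T_integrand rho alpha K f w z) =
    (Re (K w z) * Re (f z) - Im (K w z) * Im (f z)) * rho z `^ alpha.
  by rewrite /T_integrand; case: (K w z) => ? ?; case: (f z) => ? ? /=; ring.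
have ImT z : Im (T_integrand rho alpha K f w z) =
    (Re (K w z) * Im (f z) + Im (K w z) * Re (f z)) * rho z `^ alpha.
  by rewrite /T_integrand; case: (K w z) => ? ?; case: (f z) => ? ? /=; ring.
split; rewrite integrable.unlock; apply/asboolP; split.
- apply/measurable_EFinP.
  rewrite (_ : (fun z => _) = (fun z =>
    (Re (K w z) * Re (f z) - Im (K w z) * Im (f z)) * rho z `^ alpha)); last first.
    by apply/funext => z; exact: ReT.
  apply: measurable_funM => //.
  by apply: measurable_funB; apply: measurable_funM.
- apply: (@le_lt_trans _ _ (BK * B)%:E); last exact: ltry.
  apply: integral_volume_le => // z Dz; rewrite lee_fin.
  exact: le_trans (normRe_le _) (bound z Dz).
- apply/measurable_EFinP.
  rewrite (_ : (fun z => _) = (fun z =>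
    (Re (K w z) * Im (f z) + Im (K w z) * Re (f z)) * rho z `^ alpha)); last first.
    by apply/funext => z; exact: ImT.
  apply: measurable_funM => //.
  by apply: measurable_funD; apply: measurable_funM.
- apply: (@le_lt_trans _ _ (BK * B)%:E); last exact: ltry.
  apply: integral_volume_le => // z Dz; rewrite lee_fin.
  exact: le_trans (normIm_le _) (bound z Dz).
Qed.

End Reproduction.

Lemma eq_set_integral d (T : measurableType d) (R : realType)
    (mu : set T -> \bar R) (D : set T) (f g : T -> \bar R) :
  {in D, f =1 g} -> integral mu D f = integral mu D g.
Proof. by rewrite /integral => /eq_restrictP->. Qed.

Lemma pqnorm_eq (R : realType) (n : nat) (D U : set (Cn R n)) (rho : Cn R n -> R)
    (r0 p q beta : R) (f g : Cn R n -> R[i]) :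
  open D -> defining_function D U rho -> (forall z, D z -> f z = g z) ->
  pqnorm D rho r0 p q beta f = pqnorm D rho r0 p q beta g.
Proof.
move=> Dop df fg; rewrite /pqnorm; apply: (f_equal (fun x => poweR x q^-1)).
apply: eq_integral => r; rewrite inE /= in_itv /= => /andP[r_gt0 _].
have E : (\int[surface (level_domain D rho r)]_(z in frontier (level_domain D rho r))
         ((cmod (f z)) `^ p)%:E =
       \int[surface (level_domain D rho r)]_(z in frontier (level_domain D rho r))
         ((cmod (g z)) `^ p)%:E)%E.
  apply: eq_set_integral => z /set_mem fz.
  by have [Dz _] := level_frontier_out Dop df r_gt0 fz; rewrite fg.
by rewrite E.
Qed.

Theorem theorem1 (R : realType) (n : nat) (D : set (Cn R n)) (p q beta : R) :
  (0 < n)%N -> spc_domain D ->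
  0 < p -> p <= 1 -> 0 < q -> q <= 1 -> 0 < beta ->
  exists talpha0 : R,
  forall (U : set (Cn R n)) (rho : Cn R n -> R) (r0 : R)
         (Phi : Cn R n -> Cn R n -> R[i]),
  defining_function D U rho ->
  0 < r0 ->
  (forall r : R, 0 < r -> r <= r0 -> spc_domain (level_domain D rho r)) ->
  henkin_ramirez D U rho Phi ->
  forall alpha : R, talpha0 < alpha ->
  forall K : Cn R n -> Cn R n -> R[i],
  kernel_of_type D Phi alpha K -> reproducing D rho alpha K ->
  exists C : R, forall f : Cn R n -> R[i],
  Apq D rho r0 p q beta f ->
  [/\ forall w, D w -> cintegrable (volume D) D (T_integrand rho alpha K f w),
      Apq D rho r0 p q beta (T_op D rho alpha K f) &
      (pqnorm D rho r0 p q beta (T_op D rho alpha K f)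
         <= C%:E * pqnorm D rho r0 p q beta f)%E].
Proof.
move=> n_gt0 sD p0 _ q0 _ beta0.
have Dop := spc_open sD; have Dbd := spc_bounded sD.
(* the exponent of the growth bound serves as the threshold for alpha *)
pose N := Num.bound (((beta + (n.*2.-1)%:R) / p * q + 1) / q).
have hN : (beta + (n.*2.-1)%:R) / p * q + 1 <= N%:R * q.
  rewrite -ler_pdivrMr//; apply: ltW; apply: archi_boundP.
  apply: divr_ge0; last exact: ltW.
  apply: addr_ge0 => //; apply: mulr_ge0; last exact: ltW.
  by apply: divr_ge0; [apply: addr_ge0 => //; exact: ltW|exact: ltW].
exists N%:R => U rho r0 Phi df r00 _ hr alpha Na K kt rep; exists 1 => f [fD fpq].
have [e [L rs]] := regular_scale_exists n_gt0 Dbd df.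
have [C0 C00 HC0] := level_hausdorff_upper n_gt0 Dbd Dop df rs.
have C01 : 0 < C0 + 1 by rewrite ltr_wpDl.
have HC1 r : 0 < r -> r <= e ->
    (hausdorff n.*2.-1 (frontier (level_domain D rho r)) <= (C0 + 1)%:E)%E.
  by move=> r1 r2; apply: le_trans (HC0 r r1 r2) _; rewrite lee_fin lerDl.
have [B B0 fB] := growth_bound n_gt0 Dbd df rs C01 HC1 r00 p0 q0 beta0 fD fpq hN.
have fB' z : D z -> cmod (f z) * rho z `^ alpha <= B.
  move=> Dz; apply: le_trans (fB z Dz); rewrite ler_wpM2l ?cmod_ge0//.
  have rz := rho_gt0 df Dz.
  rewrite -powR_mulrn ?(ltW rz)//; apply: ger_powR; last exact: ltW.
  by rewrite rz ltW// (df_lt1 df).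
have TE w : D w -> T_op D rho alpha K f w = f w.
  exact: (T_op_reproduces rep fD B0 fB').
have nE := pqnorm_eq r0 p q beta Dop df TE.
have nE' z : D z -> \forall w \near z, f w = T_op D rho alpha K f w.
  move=> Dz; have nD : nbhs z D := open_nbhs_nbhs (conj Dop Dz).
  by apply: filterS nD => w Dw; rewrite (TE w Dw).
split.
- move=> w; exact: (T_integrand_integrable Dbd Dop df hr kt fD B0 fB').
- split; last by rewrite nE.
  move=> z Dz; apply: (@near_eq_differentiable _ (Cn R n) _ (f : Cn R n -> R[i]^o)
    (T_op D rho alpha K f) z); [exact: nE'|exact: fD].
- by rewrite nE mul1e.
Qed.
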